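(* The following parameter derivative formula holds true for $x\in\mathbb{R}$: $$\left.\frac{\partial \mathrm{M}_{\kappa,\mu}(x)}{\partial\mu}\right|_{\kappa=0}=4^{\mu}\sqrt{x}\;\Gamma(1+\mu)\left\{I_\mu\left(\frac x2\right)\left[\ln4+\psi(1+\mu)\right]+\frac{\partial I_\mu(x/2)}{\partial\mu}\right\}.$$
   Context: The Whittaker function is $\mathrm{M}_{\kappa,\mu}(x)=x^{\mu+1/2}e^{-x/2}\,{}_1F_1\!\left(\tfrac12+\mu-\kappa;\,1+2\mu;\,x\right)$, where ${}_1F_1$ is the Kummer confluent hypergeometric function (this definition is made for $2\mu\neq-1,-2,\ldots$). For $\kappa=0$ it is given by $\mathrm{M}_{0,\mu}(x)=4^{\mu}\,\Gamma(1+\mu)\sqrt{x}\,I_\mu(x/2)$, and through this expression the case $\kappa=0$, $\mu=-1/2$ is included as well. $I_\mu$ is the modified Bessel function (of the first kind), $\frac{\partial I_\mu(x/2)}{\partial\mu}$ is its derivative with respect to the order at fixed argument $x/2$, $\Gamma$ is the gamma function and $\psi=\Gamma'/\Gamma$ is the digamma function. *)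

(* Defs.v *)
From Stdlib Require Export Reals Factorial.
From Coquelicot Require Export Coquelicot.

Open Scope R_scope.

Definition Cexp (z : C) : C :=
  (exp (Re z) * cos (Im z), exp (Re z) * sin (Im z)).

(* Principal argument, with values in (-PI, PI]; in particular the argument of
   a negative real number is PI.  Only meaningful for z <> 0. *)
Definition Carg (z : C) : R :=
  if Rle_dec 0 (Im z) then acos (Re z / Cmod z) else - acos (Re z / Cmod z).

Definition Cln (z : C) : C := (ln (Cmod z), Carg z).

(* Principal branch of z^a, with the conventions 0^0 = 1 and 0^a = 0 for
   a <> 0. *)
Definition Cpower (z a : C) : C :=
  if Ceq_dec z 0 then (if Ceq_dec a 0 then RtoC 1 else RtoC 0)
  else Cexp (a * Cln z).

Definition Csqrt (z : C) : C := Cpower z (/ 2).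

(* Limits and sums are taken separately on real and imaginary parts, which
   agrees with convergence in C. *)
Definition CLim_seq (u : nat -> C) : C :=
  (real (Lim_seq (fun n => Re (u n))), real (Lim_seq (fun n => Im (u n)))).

Definition CSeries (u : nat -> C) : C :=
  (Series (fun n => Re (u n)), Series (fun n => Im (u n))).

(* Rising factorial a (a + 1) ... (a + n - 1). *)
Fixpoint pochhammer (a : C) (n : nat) : C :=
  match n with
  | O => RtoC 1
  | S m => (pochhammer a m * (a + INR m))%C
  end.

(* Euler's limit, which converges for every z other than 0, -1, -2, ...  At
   those poles the limit below is 0, because [Cinv 0 = 0]; as a consequence
   [/ CGamma z] is the entire reciprocal gamma function there as well. *)
Definition CGamma (z : C) : C :=
  CLim_seq (fun n =>
    (INR (fact n) * Cpower (INR n) z / pochhammer z (S n))%C).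

Definition Cdigamma (z : C) : C := (C_derive CGamma z / CGamma z)%C.

Definition hyp1F1 (a b z : C) : C :=
  CSeries (fun n =>
    (pochhammer a n / pochhammer b n * (z ^ n / INR (fact n)))%C).

Definition besselI (nu z : C) : C :=
  (Cpower (z / 2) nu *
   CSeries (fun k =>
     ((z / 2) ^ (2 * k) / (INR (fact k) * CGamma (nu + INR k + 1)))))%C.

Definition whittakerM_dom (kappa mu : C) : Prop :=
  (forall n : nat, (2 * mu)%C <> RtoC (- INR (S n)))
  \/ (kappa = RtoC 0 /\ mu = RtoC (- / 2)).

Definition whittakerM_1F1 (kappa mu z : C) : C :=
  (Cpower z (mu + / 2) * Cexp (- z / 2)
   * hyp1F1 (/ 2 + mu - kappa) (1 + 2 * mu) z)%C.

(* The Bessel expression is used only at the single point kappa = 0,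
   mu = -1/2, where the hypergeometric expression is undefined. *)
Definition whittakerM (kappa mu z : C) : C :=
  if Ceq_dec kappa 0 then
    if Ceq_dec mu (RtoC (- / 2)) then
      (Cpower 4 mu * CGamma (1 + mu) * Csqrt z * besselI mu (z / 2))%C
    else whittakerM_1F1 kappa mu z
  else whittakerM_1F1 kappa mu z.

(* Main.v *)
Require Import Defs.
From Stdlib Require Import Reals Lra Lia.
From Coquelicot Require Import Coquelicot.

(* For [x = 0] both sides vanish.  For [x <> 0], Kummer's second transformation
   [exp (- x / 2) 1F1 (a; 2 a; x) = 0F1 (a + 1/2; x^2 / 16)], with [a = mu + 1/2],
   gives [M (0, nu, x) = 4^nu Gamma (1 + nu) sqrt x I_nu (x / 2)] for all [nu] in a
   neighbourhood of [mu], and the formula is the product rule.  It remains to show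
   that [Gamma] and [nu |-> I_nu (x / 2)] are holomorphic.  Termwise differentiation
   needs no Cauchy theory here: the 2-jets at a point of functions on a disc carry
   a submultiplicative size, and a series (or product) of functions whose sizes are
   summable is differentiable at the point.  This applies to the [0F1] series and to
   the product obtained from the quotients of consecutive terms in Euler's limit. *)

(** * Complex exponential and complex derivatives *)

(** The Bessel form must hold on a whole neighbourhood of [mu], also when [mu] is the exceptional
    point -1/2, where the hypergeometric form is undefined. The condition [nonpole (2 * (1 + nu))]
    is open, contains that point and follows from either clause of the domain. Gamma is reached
    through its reciprocal. The quotients of consecutive terms are 1 + O(1/n^2), because the
    logarithmic increment of n^z cancels the first-order part of 1 + z/n; the product then
    telescopes into a series. A 2-jet size records a quadratic remainder with a constant uniform on
    the disc. Summing these constants bounds the remainder of the sum, so derivatives are needed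
    only at the centre. Kummer's transformation is proved on Taylor coefficients, with the
    exponential moved to the other side, so that Cauchy products of real series suffice. Since [x]
    may be negative, bases of principal powers are rescaled by positive constants only. *)

Definition Cderiv (f : C -> C) (z l : C) : Prop :=
  forall eps : R, 0 < eps -> exists delta : R, 0 < delta /\
    forall w : C, Cmod (w - z) < delta ->
      Cmod (f w - f z - l * (w - z)) <= eps * Cmod (w - z).

(** [C] carries two normed-module structures over itself: the theorem uses [C_NormedModule], the
    product and chain rules use [AbsRing_NormedModule C_AbsRing]. Both unfold to the estimate in
    [Cderiv], which serves as the bridge. *)
Lemma is_derive_Cderiv (f : C -> C) (z l : C) :
  is_derive (K := C_AbsRing) (V := C_NormedModule) f z l <-> Cderiv f z l.
Proof.
  split.
  - intros [_ H] eps Heps.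
    destruct (H z (fun P HP => HP) (mkposreal eps Heps)) as [d Hd].
    exists d. split; [apply cond_pos|].
    intros w Hw.
    rewrite (Cmult_comm l). exact (Hd w Hw).
  - intros H. split.
    + apply (is_linear_scal_l (V := C_NormedModule)).
    + intros y Hy eps.
      apply (is_filter_lim_locally_unique (V := AbsRing_NormedModule C_AbsRing)) in Hy.
      subst y.
      destruct (H eps (cond_pos eps)) as [d [Hd Hw]].
      exists (mkposreal d Hd). intros w Hb.
      generalize (Hw w Hb). rewrite (Cmult_comm l). intros H1; exact H1.
Qed.

Lemma Cmod_sub_comm (a b : C) : Cmod (a - b) = Cmod (b - a).
Proof. rewrite <- Cmod_opp. f_equal. ring. Qed.

Lemma Cmod_le_Re_Im (z : C) : Cmod z <= Rabs (Re z) + Rabs (Im z).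
Proof.
  assert (H1 := Rabs_pos (Re z)). assert (H2 := Rabs_pos (Im z)).
  apply Rsqr_incr_0_var; [|lra].
  unfold Rsqr. replace (Cmod z * Cmod z) with (Cmod z ^ 2) by ring.
  rewrite Cmod2_alt, <- (pow2_abs (Re z)), <- (pow2_abs (Im z)). nra.
Qed.

Lemma im_le_Cmod (z : C) : Rabs (Im z) <= Cmod z.
Proof.
  apply Rle_trans with (2 := Rmax_Cmod z). apply Rmax_r.
Qed.

(** * Estimates for the complex exponential *)

Lemma Cexp_add (a b : C) : Cexp (a + b) = (Cexp a * Cexp b)%C.
Proof.
  destruct a as [a a'], b as [b b']. unfold Cexp, Cmult, Cplus. simpl.
  rewrite exp_plus, cos_plus, sin_plus. f_equal; ring.
Qed.

Lemma Cexp_RtoC (x : R) : Cexp x = RtoC (exp x).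
Proof.
  unfold Cexp, RtoC. simpl. rewrite cos_0, sin_0. f_equal; ring.
Qed.

Lemma Cexp_0 : Cexp 0 = RtoC 1.
Proof. rewrite Cexp_RtoC, exp_0. reflexivity. Qed.

Lemma Cexp_neq_0 (a : C) : Cexp a <> 0.
Proof.
  intros H. apply C1_nz.
  rewrite <- Cexp_0. replace (RtoC 0) with (a + - a)%C by ring.
  rewrite Cexp_add, H. ring.
Qed.

Lemma Cmod_Cexp (s : C) : Cmod (Cexp s) = exp (Re s).
Proof.
  unfold Cmod, Cexp. simpl.
  replace (_ + _) with ((exp (Re s)) ^ 2 * ((sin (Im s))² + (cos (Im s))²)) by (unfold Rsqr; ring).
  rewrite sin2_cos2, Rmult_1_r. apply sqrt_pow2. left; apply exp_pos.
Qed.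

Lemma exp_le_exp (x y : R) : x <= y -> exp x <= exp y.
Proof. intros [H | ->]; [left; now apply exp_increasing | lra]. Qed.

Lemma Cmod_Cexp_le (s : C) : Cmod (Cexp s) <= exp (Cmod s).
Proof.
  rewrite Cmod_Cexp. apply exp_le_exp.
  apply Rle_trans with (1 := Rle_abs _), re_le_Cmod.
Qed.

(** Here and in the next lemma everything follows from 1 + t <= exp t at [a] and at [- a], the
    latter multiplied by [exp a]. *)
Lemma exp_sub_one_le (a : R) : Rabs (exp a - 1) <= Rabs a * exp (Rabs a).
Proof.
  assert (H1 := exp_ineq1_le a). assert (H2 := exp_ineq1_le (- a)).
  assert (H3 := exp_pos a). assert (H4 : exp a * exp (- a) = 1)
    by (rewrite <- exp_plus, Rplus_opp_r; apply exp_0).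
  destruct (Rle_dec 0 a).
  - rewrite (Rabs_pos_eq a), Rabs_pos_eq by lra. nra.
  - rewrite (Rabs_left a), Rabs_left1 by (try lra; nra).
    assert (exp a <= 1) by (rewrite <- exp_0; apply exp_le_exp; lra). nra.
Qed.

Lemma exp_taylor1_le (a : R) : Rabs (exp a - 1 - a) <= a ^ 2 * exp (Rabs a).
Proof.
  assert (H1 := exp_ineq1_le a). assert (H2 := exp_ineq1_le (- a)).
  assert (H3 := exp_pos a). assert (H4 : exp a * exp (- a) = 1)
    by (rewrite <- exp_plus, Rplus_opp_r; apply exp_0).
  assert (H5 : exp a * (1 - a) <= 1) by nra.
  rewrite Rabs_pos_eq by lra.
  destruct (Rle_dec 0 a).
  - rewrite (Rabs_pos_eq a) by lra.
    assert (exp a - 1 <= a * exp a) by lra.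
    assert (a * (exp a - 1) <= a * (a * exp a)) by (apply Rmult_le_compat_l; lra).
    nra.
  - rewrite (Rabs_left a) by lra.
    assert (1 <= exp (- a)) by lra. nra.
Qed.

Lemma Rabs_sin_le (b : R) : Rabs (sin b) <= Rabs b.
Proof.
  assert (H : forall x, 0 < x -> Rabs (sin x) <= x).
  { intros x Hx. apply Rabs_le. split; [|left; now apply sin_lt_x].
    destruct (Rle_dec x 1).
    - assert (0 <= sin x); [apply sin_ge_0; generalize PI2_1; lra | lra].
    - generalize (SIN_bound x); lra. }
  destruct (Rtotal_order b 0) as [h | [-> | h]].
  - rewrite <- (Rabs_Ropp (sin b)), <- sin_neg, (Rabs_left b) by lra. apply H; lra.
  - rewrite sin_0. lra.
  - rewrite (Rabs_pos_eq b) by lra. now apply H.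
Qed.

Lemma one_sub_cos_eq (b : R) : 1 - cos b = 2 * sin (b / 2) ^ 2.
Proof.
  replace (cos b) with (cos (2 * (b / 2))) by (f_equal; field).
  rewrite cos_2a_sin. ring.
Qed.

Lemma Rabs_cos_sub_one_le (b : R) : Rabs (cos b - 1) <= b ^ 2.
Proof.
  rewrite Rabs_minus_sym, one_sub_cos_eq.
  assert (H := Rabs_sin_le (b / 2)).
  rewrite Rabs_pos_eq by nra.
  rewrite <- pow2_abs, <- (pow2_abs b).
  unfold Rdiv in H. rewrite Rabs_mult, (Rabs_pos_eq (/ 2)) in H by lra.
  assert (H0 := Rabs_pos (sin (b * / 2))). unfold Rdiv.
  assert (Rabs (sin (b * / 2)) ^ 2 <= (Rabs b * / 2) ^ 2) by (apply pow_incr; lra). nra.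
Qed.

Lemma Rabs_cos_sub_one_le_1 (b : R) : Rabs (cos b - 1) <= Rabs b.
Proof.
  rewrite Rabs_minus_sym, one_sub_cos_eq.
  assert (H := Rabs_sin_le (b / 2)).
  rewrite Rabs_pos_eq by nra.
  rewrite <- pow2_abs.
  unfold Rdiv in *. rewrite Rabs_mult, (Rabs_pos_eq (/ 2)) in H by lra.
  assert (H0 := Rabs_pos (sin (b * / 2))).
  assert (Rabs (sin (b * / 2)) <= 1) by (apply Rabs_le, SIN_bound). nra.
Qed.

Lemma Rabs_sin_sub_le (b : R) : Rabs (sin b - b) <= b ^ 2.
Proof.
  destruct (MVT_gen (fun t => sin t - t) 0 b (fun t => cos t - 1)) as [c [Hc He]].
  - intros t _. auto_derive; trivial. ring.
  - intros t _. apply continuity_pt_minus; [apply continuity_sin | apply continuity_pt_id].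
  - rewrite sin_0 in He. replace (sin b - b) with ((cos c - 1) * b) by lra.
    rewrite Rabs_mult, <- (pow2_abs b).
    assert (Rabs c <= Rabs b).
    { revert Hc. unfold Rmin, Rmax. destruct (Rle_dec 0 b); intros Hc.
      - rewrite !Rabs_pos_eq; lra.
      - rewrite !Rabs_left1; lra. }
    assert (H1 := Rabs_cos_sub_one_le_1 c).
    assert (H2 := Rabs_pos b). nra.
Qed.

(** With [s = (a, b)], the real part is (exp a - 1 - a) + exp a (cos b - 1) and the imaginary part
    (exp a - 1) sin b + (sin b - b). Each is at most 2 m^2 exp m with m = |s|, whence the constant
    4. *)
Lemma Cexp_taylor1_le (s : C) :
  Cmod (Cexp s - 1 - s) <= 4 * Cmod s ^ 2 * exp (Cmod s).
Proof.
  apply Rle_trans with (1 := Cmod_le_Re_Im _).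
  destruct s as [a b]. assert (Ha := re_le_Cmod (a, b)). assert (Hb := im_le_Cmod (a, b)).
  unfold Re, Im in *; simpl in Ha, Hb |- *. set (m := Cmod (a, b)) in *.
  assert (E := exp_le_exp _ _ Ha). assert (E0 := exp_pos (Rabs a)).
  assert (E1 : 1 <= exp m).
  { rewrite <- exp_0. apply exp_le_exp. apply Rle_trans with (2 := Ha), Rabs_pos. }
  assert (E2 : exp a <= exp m) by (apply exp_le_exp; apply Rle_trans with (2 := Ha), Rle_abs).
  assert (Pa := Rabs_pos a). assert (Pb := Rabs_pos b).
  assert (A1 := exp_taylor1_le a). assert (A2 := exp_sub_one_le a).
  assert (B1 := Rabs_cos_sub_one_le b). assert (B2 := Rabs_sin_le b). assert (B3 := Rabs_sin_sub_le b).
  assert (Sa : Rabs a ^ 2 <= m ^ 2) by (apply pow_incr; lra).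
  assert (Sb : Rabs b ^ 2 <= m ^ 2) by (apply pow_incr; lra).
  assert (Sab : Rabs a * Rabs b <= m ^ 2) by (simpl; rewrite Rmult_1_r; apply Rmult_le_compat; lra).
  rewrite pow2_abs in Sa, Sb.
  assert (Q : 0 <= m ^ 2) by apply pow2_ge_0.
  assert (Qa : 0 <= a ^ 2) by apply pow2_ge_0.
  assert (Qb : 0 <= b ^ 2) by apply pow2_ge_0.
  assert (R1 : Rabs (exp a * cos b + - 1 + - a) <= 2 * (m ^ 2 * exp m)).
  { replace (_ + _ + _) with ((exp a - 1 - a) + exp a * (cos b - 1)) by ring.
    apply Rle_trans with (1 := Rabs_triang _ _). rewrite Rabs_mult, (Rabs_pos_eq (exp a)) by (left; apply exp_pos).
    assert (a ^ 2 * exp (Rabs a) <= m ^ 2 * exp m) by (apply Rmult_le_compat; lra).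
    assert (exp a * Rabs (cos b - 1) <= exp m * m ^ 2)
      by (apply Rmult_le_compat; try lra; [left; apply exp_pos | apply Rabs_pos]). lra. }
  assert (R2 : Rabs (exp a * sin b + - 0 + - b) <= 2 * (m ^ 2 * exp m)).
  { replace (_ + _ + _) with ((exp a - 1) * sin b + (sin b - b)) by ring.
    apply Rle_trans with (1 := Rabs_triang _ _). rewrite Rabs_mult.
    assert (Rabs (exp a - 1) * Rabs (sin b) <= (Rabs a * exp (Rabs a)) * Rabs b)
      by (apply Rmult_le_compat; try lra; apply Rabs_pos).
    assert ((Rabs a * Rabs b) * exp (Rabs a) <= m ^ 2 * exp m)
      by (apply Rmult_le_compat; try lra; nra).
    nra. }
  change (Rabs (exp a * cos b + - 1 + - a) + Rabs (exp a * sin b + - 0 + - b) <= 4 * m ^ 2 * exp m).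
  lra.
Qed.

(** * Rules for complex derivatives *)

Lemma is_derive_AbsRing_Cderiv (f : C -> C) (z l : C) :
  is_derive (K := C_AbsRing) (V := AbsRing_NormedModule C_AbsRing) f z l <-> Cderiv f z l.
Proof.
  rewrite <- is_derive_Cderiv. split.
  - intros [_ H]. split; [apply (is_linear_scal_l (V := C_NormedModule)) | exact H].
  - intros [_ H]. split; [apply (is_linear_scal_l (V := AbsRing_NormedModule C_AbsRing)) | exact H].
Qed.

Lemma Cderiv_mult (f g : C -> C) (z df dg : C) :
  Cderiv f z df -> Cderiv g z dg ->
  Cderiv (fun w => f w * g w)%C z (df * g z + f z * dg)%C.
Proof.
  rewrite <- !is_derive_AbsRing_Cderiv. intros Hf Hg.
  exact (is_derive_mult (K := C_AbsRing) f g z df dg Hf Hg Cmult_comm).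
Qed.

Lemma Cderiv_comp (f g : C -> C) (z df dg : C) :
  Cderiv f (g z) df -> Cderiv g z dg -> Cderiv (fun w => f (g w)) z (dg * df)%C.
Proof.
  rewrite <- !is_derive_AbsRing_Cderiv. intros Hf Hg.
  exact (is_derive_comp (K := C_AbsRing) (V := AbsRing_NormedModule C_AbsRing) f g z df dg Hf Hg).
Qed.

Lemma Cderiv_ext_loc (f g : C -> C) (z l : C) (r : R) :
  0 < r -> (forall w, Cmod (w - z) < r -> f w = g w) -> Cderiv f z l -> Cderiv g z l.
Proof.
  intros Hr Hfg H eps Heps. destruct (H eps Heps) as [d [Hd Hw]].
  exists (Rmin r d). split; [now apply Rmin_pos|].
  intros w Hm.
  rewrite <- (Hfg w), <- (Hfg z).
  - apply Hw. apply Rlt_le_trans with (1 := Hm), Rmin_r.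
  - replace (z - z)%C with (RtoC 0) by ring. now rewrite Cmod_0.
  - apply Rlt_le_trans with (1 := Hm), Rmin_l.
Qed.

Lemma Cderiv_quadratic (f : C -> C) (z l : C) (r K : R) :
  0 < r ->
  (forall w, Cmod (w - z) < r -> Cmod (f w - f z - l * (w - z)) <= K * Cmod (w - z) ^ 2) ->
  Cderiv f z l.
Proof.
  intros Hr H eps Heps.
  assert (HK : 0 < Rabs K + 1) by (generalize (Rabs_pos K); lra).
  (* [Rabs K + 1] is positive whatever the sign of [K]; this radius makes K |w - z| <= eps. *)
  exists (Rmin r (eps / (Rabs K + 1))). split.
  - apply Rmin_pos; [easy | now apply Rdiv_lt_0_compat].
  - intros w Hw. assert (H1 := Rlt_le_trans _ _ _ Hw (Rmin_l _ _)).
    assert (H2 := Rlt_le_trans _ _ _ Hw (Rmin_r _ _)).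
    apply Rle_trans with (1 := H w H1).
    apply Rlt_div_r in H2; [|easy].
    assert (H3 := Cmod_ge_0 (w - z)). assert (H4 := Rle_abs K).
    set (m := Cmod (w - z)) in *.
    assert (K * m <= eps) by nra. nra.
Qed.

Lemma Cderiv_const (c z : C) : Cderiv (fun _ => c) z 0.
Proof.
  apply (Cderiv_quadratic _ _ _ 1 0); [lra|]. intros w _.
  replace (c - c - 0 * (w - z))%C with (RtoC 0) by ring. rewrite Cmod_0. lra.
Qed.

Lemma Cderiv_add_const (c z : C) : Cderiv (fun w => c + w)%C z 1.
Proof.
  apply (Cderiv_quadratic _ _ _ 1 0); [lra|]. intros w _.
  replace (_ - _ - _)%C with (RtoC 0) by ring. rewrite Cmod_0. lra.
Qed.

Lemma Cderiv_Cinv (z : C) : z <> 0 -> Cderiv Cinv z (- / (z * z))%C.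
Proof.
  intros Hz. assert (Hm := proj1 (Cmod_gt_0 z) Hz).
  (* The remainder is exactly (w - z)^2 / (w z^2), and 1/|w| <= 2/|z| on the disc of radius
     |z|/2. *)
  apply (Cderiv_quadratic _ _ _ (Cmod z / 2) (2 / Cmod z ^ 3)); [lra|].
  intros w Hw.
  assert (H1 : Cmod z / 2 <= Cmod w).
  { assert (H := Cmod_triangle (z - w) w). rewrite (Cmod_sub_comm z w) in H.
    replace (z - w + w)%C with z in H by ring. lra. }
  assert (Hw0 : w <> 0) by (apply Cmod_gt_0; lra).
  replace (/ w - / z - - / (z * z) * (w - z))%C
    with ((w - z) * (w - z) / (w * (z * z)))%C by (field; auto).
  rewrite Cmod_div by (repeat apply Cmult_neq_0; auto).
  rewrite !Cmod_mult.
  assert (H3 : / Cmod w <= 2 / Cmod z).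
  { replace (2 / Cmod z) with (/ (Cmod z / 2)) by (field; lra).
    apply Rinv_le_contravar; lra. }
  assert (H4 := Cmod_ge_0 (w - z)).
  replace (2 / Cmod z ^ 3 * Cmod (w - z) ^ 2)
    with ((Cmod (w - z) ^ 2 / Cmod z ^ 2) * (2 / Cmod z)) by (field; lra).
  replace (_ / (_ * _)) with ((Cmod (w - z) ^ 2 / Cmod z ^ 2) * / Cmod w) by (field; lra).
  apply Rmult_le_compat_l; [|easy].
  apply Rdiv_le_0_compat; [apply pow2_ge_0 | apply pow_lt; lra].
Qed.

Lemma Cderiv_inv (f : C -> C) (z df : C) :
  f z <> 0 -> Cderiv f z df -> Cderiv (fun w => / f w)%C z (df * - / (f z * f z))%C.
Proof.
  intros Hz Hf. apply (Cderiv_comp Cinv f); [now apply Cderiv_Cinv | easy].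
Qed.

Lemma Cderiv_Cexp (z : C) : Cderiv Cexp z (Cexp z).
Proof.
  apply (Cderiv_quadratic _ _ _ 1 (Cmod (Cexp z) * (4 * exp 1))); [lra|].
  intros w Hw.
  replace (Cexp w) with (Cexp z * Cexp (w - z))%C by (rewrite <- Cexp_add; f_equal; ring).
  replace (_ - _ - _)%C with (Cexp z * (Cexp (w - z) - 1 - (w - z)))%C by ring.
  rewrite Cmod_mult, Rmult_assoc. apply Rmult_le_compat_l; [apply Cmod_ge_0|].
  apply Rle_trans with (1 := Cexp_taylor1_le _).
  assert (H := exp_le_exp (Cmod (w - z)) 1). assert (H1 := pow2_ge_0 (Cmod (w - z))).
  assert (exp (Cmod (w - z)) <= exp 1) by (apply H; lra). nra.
Qed.

Lemma Cderiv_mul_const (c z : C) : Cderiv (fun w => w * c)%C z c.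
Proof.
  apply (Cderiv_quadratic _ _ _ 1 0); [lra|]. intros w _.
  replace (_ - _ - _)%C with (RtoC 0) by ring. rewrite Cmod_0. lra.
Qed.

(** * Series of functions with summable 2-jets *)

(** [CSeries] has a value even for a divergent series; this predicate carries the convergence.
    [Cconv] does the same for [CLim_seq]. *)
Definition Csums (u : nat -> C) (s : C) : Prop :=
  is_series (fun n => Re (u n)) (Re s) /\ is_series (fun n => Im (u n)) (Im s).

Lemma Csums_unique (u : nat -> C) (s : C) : Csums u s -> CSeries u = s.
Proof.
  intros [H1 H2]. unfold CSeries.
  rewrite (is_series_unique _ _ H1), (is_series_unique _ _ H2). now destruct s.
Qed.

Lemma Csums_ext (u v : nat -> C) (s : C) : (forall n, u n = v n) -> Csums u s -> Csums v s.
Proof.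
  intros H [H1 H2]. split.
  - apply is_series_ext with (2 := H1). intros n; now rewrite H.
  - apply is_series_ext with (2 := H2). intros n; now rewrite H.
Qed.

Lemma CSeries_ext (u v : nat -> C) : (forall n, u n = v n) -> CSeries u = CSeries v.
Proof.
  intros H. unfold CSeries. f_equal; apply Series_ext; intros n; now rewrite H.
Qed.

Lemma Csums_plus (u v : nat -> C) (s t : C) :
  Csums u s -> Csums v t -> Csums (fun n => u n + v n)%C (s + t)%C.
Proof.
  intros [H1 H2] [H3 H4]. split.
  - exact (is_series_plus _ _ _ _ H1 H3).
  - exact (is_series_plus _ _ _ _ H2 H4).
Qed.

Lemma Csums_scal (c : C) (u : nat -> C) (s : C) :
  Csums u s -> Csums (fun n => c * u n)%C (c * s)%C.
Proof.
  intros [H1 H2]. destruct c as [a b]. split.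
  - exact (is_series_minus _ _ _ _ (is_series_scal a _ _ H1) (is_series_scal b _ _ H2)).
  - exact (is_series_plus _ _ _ _ (is_series_scal a _ _ H2) (is_series_scal b _ _ H1)).
Qed.

Lemma Csums_dominated (u : nat -> C) (a : nat -> R) :
  (forall n, Cmod (u n) <= a n) -> ex_series a -> Csums u (CSeries u).
Proof.
  intros H Ha. unfold Csums, CSeries; simpl. split; apply Series_correct.
  - apply (ex_series_le (K := R_AbsRing) (V := R_CompleteNormedModule)) with (2 := Ha).
    intros n. apply Rle_trans with (1 := re_le_Cmod (u n)), H.
  - apply (ex_series_le (K := R_AbsRing) (V := R_CompleteNormedModule)) with (2 := Ha).
    intros n. apply Rle_trans with (1 := im_le_Cmod (u n)), H.
Qed.

Lemma Rabs_series_le (u a : nat -> R) (s t : R) :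
  (forall n, Rabs (u n) <= a n) -> is_series u s -> is_series a t -> Rabs s <= t.
Proof.
  intros H Hs Ht. rewrite <- (is_series_unique _ _ Hs), <- (is_series_unique _ _ Ht).
  assert (E : ex_series (fun n => Rabs (u n))).
  { apply (ex_series_le (K := R_AbsRing) (V := R_CompleteNormedModule)) with (b := a).
    - intros n. change (Rabs (Rabs (u n)) <= a n). now rewrite Rabs_Rabsolu.
    - now exists t. }
  apply Rle_trans with (1 := Series_Rabs _ E).
  apply Series_le; [|now exists t]. intros n; split; [apply Rabs_pos | apply H].
Qed.

(** The factor 2 is the price of bounding real and imaginary parts separately; only finiteness of
    the bound matters later. *)
Lemma Cmod_sums_le (u : nat -> C) (a : nat -> R) (s : C) (t : R) :
  (forall n, Cmod (u n) <= a n) -> Csums u s -> is_series a t -> Cmod s <= 2 * t.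
Proof.
  intros H [H1 H2] Ht. apply Rle_trans with (1 := Cmod_le_Re_Im s).
  assert (Rabs (Re s) <= t).
  { apply Rabs_series_le with (2 := H1) (3 := Ht). intros n.
    apply Rle_trans with (1 := re_le_Cmod (u n)), H. }
  assert (Rabs (Im s) <= t).
  { apply Rabs_series_le with (2 := H2) (3 := Ht). intros n.
    apply Rle_trans with (1 := im_le_Cmod (u n)), H. }
  lra.
Qed.

(* [al + be * e + ga * e^2] is a majorant of the 2-jet of [f] at [z], uniform on
   the disc of radius [r].  Multiplying majorants shows that the size
   [al + be + ga] is submultiplicative, like a norm on [C[e]/(e^3)]. *)
Definition jet_bound (z : C) (r : R) (f : C -> C) (d : C) (a : R) : Prop :=
  exists al be ga : R, 0 <= al /\ 0 <= be /\ 0 <= ga /\ al + be + ga <= a /\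
    Cmod d <= be /\
    forall w, Cmod (w - z) < r ->
      Cmod (f w) <= al /\
      Cmod (f w - f z) <= be * Cmod (w - z) /\
      Cmod (f w - f z - d * (w - z)) <= ga * Cmod (w - z) ^ 2.

Lemma jet_bound_le (z : C) (r : R) (f : C -> C) (d : C) (a b : R) :
  a <= b -> jet_bound z r f d a -> jet_bound z r f d b.
Proof.
  intros Hab (al & be & ga & H1 & H2 & H3 & H4 & H5). exists al, be, ga.
  repeat split; try easy; try lra; now apply H5.
Qed.

Lemma jet_bound_ext (z : C) (r : R) (f g : C -> C) (d e : C) (a : R) :
  (forall w, f w = g w) -> d = e -> jet_bound z r f d a -> jet_bound z r g e a.
Proof.
  intros Hfg -> (al & be & ga & H1 & H2 & H3 & H4 & H5 & H). exists al, be, ga.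
  repeat split; try easy; rewrite <- ?Hfg; now apply H.
Qed.

Lemma jet_bound_pos (z : C) (r : R) (f : C -> C) (d : C) (a : R) : jet_bound z r f d a -> 0 <= a.
Proof. intros (al & be & ga & H1 & H2 & H3 & H4 & _). lra. Qed.

Lemma jet_bound_Cmod (z : C) (r : R) (f : C -> C) (d : C) (a : R) :
  jet_bound z r f d a -> forall w, Cmod (w - z) < r -> Cmod (f w) <= a.
Proof.
  intros (al & be & ga & H1 & H2 & H3 & H4 & H5 & H) w Hw.
  apply Rle_trans with (1 := proj1 (H w Hw)). lra.
Qed.

Lemma jet_bound_plus (z : C) (r : R) (f g : C -> C) (d e : C) (a b : R) :
  jet_bound z r f d a -> jet_bound z r g e b ->
  jet_bound z r (fun w => f w + g w)%C (d + e)%C (a + b).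
Proof.
  intros (al & be & ga & H1 & H2 & H3 & H4 & H5 & H) (al' & be' & ga' & H1' & H2' & H3' & H4' & H5' & H').
  exists (al + al'), (be + be'), (ga + ga').
  repeat split; try lra.
  - apply Rle_trans with (1 := Cmod_triangle _ _). lra.
  - destruct (H w H0) as (E1 & E2 & E3), (H' w H0) as (E1' & E2' & E3').
    apply Rle_trans with (1 := Cmod_triangle _ _). lra.
  - destruct (H w H0) as (E1 & E2 & E3), (H' w H0) as (E1' & E2' & E3').
    replace (f w + g w - (f z + g z))%C with ((f w - f z) + (g w - g z))%C by ring.
    apply Rle_trans with (1 := Cmod_triangle _ _). lra.
  - destruct (H w H0) as (E1 & E2 & E3), (H' w H0) as (E1' & E2' & E3').
    replace (f w + g w - (f z + g z) - (d + e) * (w - z))%C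
      with ((f w - f z - d * (w - z)) + (g w - g z - e * (w - z)))%C by ring.
    apply Rle_trans with (1 := Cmod_triangle _ _). lra.
Qed.

Lemma jet_bound_mult (z : C) (r : R) (f g : C -> C) (d e : C) (a b : R) :
  0 < r -> jet_bound z r f d a -> jet_bound z r g e b ->
  jet_bound z r (fun w => f w * g w)%C (d * g z + f z * e)%C (a * b).
Proof.
  intros Hr (al & be & ga & H1 & H2 & H3 & H4 & H5 & H) (al' & be' & ga' & H1' & H2' & H3' & H4' & H5' & H').
  assert (Hzz : Cmod (z - z) < r) by (replace (z - z)%C with (RtoC 0) by ring; now rewrite Cmod_0).
  destruct (H z Hzz) as (Z1 & _ & _), (H' z Hzz) as (Z1' & _ & _).
  (* These are the coefficients of the product of the two majorants, truncated after degree 2; the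
     terms of degrees 3 and 4 are nonnegative and are dropped in the bound of the size. *)
  exists (al * al'), (be * al' + al * be'), (al * ga' + be * be' + ga * al').
  split; [nra|]. split; [nra|]. split; [nra|]. split.
  { assert ((al + be + ga) * (al' + be' + ga') <= a * b) by (apply Rmult_le_compat; lra).
    assert (0 <= be * ga') by nra. assert (0 <= ga * be') by nra. assert (0 <= ga * ga') by nra. nra. }
  split.
  { apply Rle_trans with (1 := Cmod_triangle _ _). rewrite !Cmod_mult.
    apply Rplus_le_compat; apply Rmult_le_compat; try apply Cmod_ge_0; lra. }
  intros w Hw. destruct (H w Hw) as (E1 & E2 & E3), (H' w Hw) as (E1' & E2' & E3').
  assert (Hm := Cmod_ge_0 (w - z)). set (m := Cmod (w - z)) in *.
  split; [|split].
  - rewrite Cmod_mult. apply Rmult_le_compat; try apply Cmod_ge_0; lra.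
  - replace (f w * g w - f z * g z)%C with ((f w - f z) * g w + f z * (g w - g z))%C by ring.
    apply Rle_trans with (1 := Cmod_triangle _ _). rewrite !Cmod_mult.
    replace ((be * al' + al * be') * m) with ((be * m) * al' + al * (be' * m)) by ring.
    apply Rplus_le_compat; apply Rmult_le_compat; try apply Cmod_ge_0; lra.
  - replace (f w * g w - f z * g z - (d * g z + f z * e) * (w - z))%C
      with ((f w - f z - d * (w - z)) * g z
            + ((f w - f z) * (g w - g z) + f z * (g w - g z - e * (w - z))))%C by ring.
    apply Rle_trans with (1 := Cmod_triangle _ _).
    replace ((al * ga' + be * be' + ga * al') * m ^ 2)
      with ((ga * m ^ 2) * al' + ((be * m) * (be' * m) + al * (ga' * m ^ 2))) by ring.
    apply Rplus_le_compat; [|apply Rle_trans with (1 := Cmod_triangle _ _); apply Rplus_le_compat];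
      rewrite Cmod_mult; apply Rmult_le_compat; try apply Cmod_ge_0; lra.
Qed.

Lemma jet_bound_const (z : C) (r : R) (c : C) : jet_bound z r (fun _ => c) 0 (Cmod c).
Proof.
  exists (Cmod c), 0, 0. assert (H := Cmod_ge_0 c). rewrite Cmod_0.
  repeat split; try lra; replace (c - c)%C with (RtoC 0) by ring.
  - rewrite Cmod_0; lra.
  - replace (_ - _)%C with (RtoC 0) by ring. rewrite Cmod_0; lra.
Qed.

Lemma jet_bound_id (z : C) (r : R) : 0 < r -> jet_bound z r (fun w => w) 1 (Cmod z + r + 1).
Proof.
  intros Hr. exists (Cmod z + r), 1, 0. assert (H := Cmod_ge_0 z). rewrite Cmod_1.
  repeat split; try lra.
  - assert (H1 := Cmod_triangle (w - z) z). replace (w - z + z)%C with w in H1 by ring. lra.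
  - replace (_ - _ - _)%C with (RtoC 0) by ring. rewrite Cmod_0; lra.
Qed.

(** The difference and the first-order remainder are, up to sign, w - z times a product of two such
    reciprocals and (w - z)^2 times a product of three, each reciprocal being at most [M]. *)
Lemma jet_bound_inv_add (z : C) (r : R) (c : C) (M : R) :
  0 < r -> (forall w, Cmod (w - z) < r -> w + c <> 0 /\ / Cmod (w + c) <= M)%C ->
  jet_bound z r (fun w => / (w + c))%C (- / ((z + c) * (z + c)))%C (M + M ^ 2 + M ^ 3).
Proof.
  intros Hr H.
  assert (Hzz : Cmod (z - z) < r) by (replace (z - z)%C with (RtoC 0) by ring; now rewrite Cmod_0).
  destruct (H z Hzz) as [Z1 Z2].
  assert (Z3 : 0 < / Cmod (z + c)) by now apply Rinv_0_lt_compat, Cmod_gt_0.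
  exists M, (M ^ 2), (M ^ 3).
  split; [lra|]. split; [apply pow_le; lra|]. split; [apply pow_le; lra|]. split; [lra|]. split.
  { rewrite Cmod_opp, Cmod_inv, Cmod_mult, Rinv_mult by now apply Cmult_neq_0. simpl.
    rewrite Rmult_1_r. apply Rmult_le_compat; lra. }
  intros w Hw. destruct (H w Hw) as [W1 W2].
  assert (W3 : 0 < / Cmod (w + c)) by now apply Rinv_0_lt_compat, Cmod_gt_0.
  assert (Hm := Cmod_ge_0 (w - z)).
  assert (Hmm : 0 <= Cmod (w - z) ^ 2) by apply pow2_ge_0.
  assert (P2 : / Cmod (w + c) * / Cmod (z + c) <= M ^ 2)
    by (simpl; rewrite Rmult_1_r; apply Rmult_le_compat; lra).
  split; [|split].
  - now rewrite Cmod_inv.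
  - replace (/ (w + c) - / (z + c))%C with (- ((w - z) * (/ (w + c) * / (z + c))))%C by (field; auto).
    rewrite Cmod_opp, !Cmod_mult, !Cmod_inv, Rmult_comm by easy.
    apply Rmult_le_compat_r; lra.
  - replace (_ - _ - _)%C with (((w - z) * (w - z)) * (/ (w + c) * / (z + c) * / (z + c)))%C by (field; auto).
    rewrite !Cmod_mult, !Cmod_inv, Rmult_comm by easy.
    replace (Cmod (w - z) * Cmod (w - z)) with (Cmod (w - z) ^ 2) by ring.
    apply Rmult_le_compat_r; [easy|].
    replace (M ^ 3) with (M ^ 2 * M) by ring. apply Rmult_le_compat; try lra. nra.
Qed.

(** The first-order remainder of the sum is the sum of the first-order remainders, and the n-th of
    them is at most [a n] times |w - z|^2 on the whole disc. The constant [2 * A] inherits its 2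
    from [Cmod_sums_le]. *)
Lemma jet_bound_series (z : C) (r : R) (f : nat -> C -> C) (d : nat -> C) (a : nat -> R) :
  0 < r -> (forall n, jet_bound z r (f n) (d n) (a n)) -> ex_series a ->
  (forall w, Cmod (w - z) < r -> Csums (fun n => f n w) (CSeries (fun n => f n w))) /\
  Cderiv (fun w => CSeries (fun n => f n w)) z (CSeries d).
Proof.
  intros Hr H Ha.
  assert (S : forall w, Cmod (w - z) < r -> Csums (fun n => f n w) (CSeries (fun n => f n w))).
  { intros w Hw. apply Csums_dominated with (2 := Ha). intros n.
    now apply (jet_bound_Cmod _ _ _ _ _ (H n)). }
  split; [exact S|].
  assert (D : Csums d (CSeries d)).
  { apply Csums_dominated with (2 := Ha). intros n.
    destruct (H n) as (al & be & ga & H1 & H2 & H3 & H4 & H5 & _). lra. }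
  destruct Ha as [A HA].
  apply (Cderiv_quadratic _ _ _ r (2 * A) Hr). intros w Hw.
  assert (Hzz : Cmod (z - z) < r) by (replace (z - z)%C with (RtoC 0) by ring; now rewrite Cmod_0).
  assert (T := Csums_plus _ _ _ _ (Csums_plus _ _ _ _ (S w Hw) (Csums_scal (-(1)) _ _ (S z Hzz)))
    (Csums_scal (- (w - z)) _ _ D)).
  replace (_ - _ - _)%C with
    (CSeries (fun n => f n w) + -(1) * CSeries (fun n => f n z) + - (w - z) * CSeries d)%C by ring.
  rewrite Rmult_assoc.
  apply (Cmod_sums_le _ (fun n => a n * Cmod (w - z) ^ 2) _ _) with (2 := T).
  - intros n. destruct (H n) as (al & be & ga & H1 & H2 & H3 & H4 & H5 & H6).
    destruct (H6 w Hw) as (_ & _ & E).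
    replace (f n w + - (1) * f n z + - (w - z) * d n)%C with (f n w - f n z - d n * (w - z))%C by ring.
    apply Rle_trans with (1 := E), Rmult_le_compat_r; [apply pow2_ge_0 | lra].
  - apply is_series_ext with (fun n => Cmod (w - z) ^ 2 * a n); [intros; apply Rmult_comm|].
    rewrite Rmult_comm. exact (is_series_scal _ _ _ HA).
Qed.

(** * Infinite products *)

Definition Cconv (u : nat -> C) (l : C) : Prop :=
  is_lim_seq (fun n => Re (u n)) (Re l) /\ is_lim_seq (fun n => Im (u n)) (Im l).

Lemma Cconv_CLim_seq (u : nat -> C) (l : C) : Cconv u l -> CLim_seq u = l.
Proof.
  intros [H1 H2]. unfold CLim_seq.
  rewrite (is_lim_seq_unique _ _ H1), (is_lim_seq_unique _ _ H2). now destruct l.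
Qed.

Lemma Cconv_ext (u v : nat -> C) (l : C) : (forall n, u n = v n) -> Cconv u l -> Cconv v l.
Proof.
  intros H [H1 H2].
  split; [apply is_lim_seq_ext with (2 := H1) | apply is_lim_seq_ext with (2 := H2)];
    intros n; now rewrite H.
Qed.

Lemma Cconv_incr_1 (u : nat -> C) (l : C) : Cconv (fun n => u (S n)) l <-> Cconv u l.
Proof.
  unfold Cconv. rewrite <- (is_lim_seq_incr_1 (fun n => Re (u n))).
  now rewrite <- (is_lim_seq_incr_1 (fun n => Im (u n))).
Qed.

Lemma Cconv_const (c : C) : Cconv (fun _ => c) c.
Proof. split; apply is_lim_seq_const. Qed.

Lemma Cconv_plus (u v : nat -> C) (l m : C) :
  Cconv u l -> Cconv v m -> Cconv (fun n => u n + v n)%C (l + m)%C.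
Proof. intros [H1 H2] [H3 H4]. split; apply is_lim_seq_plus'; assumption. Qed.

Lemma Cconv_mult (u v : nat -> C) (l m : C) :
  Cconv u l -> Cconv v m -> Cconv (fun n => u n * v n)%C (l * m)%C.
Proof.
  intros [H1 H2] [H3 H4]. split.
  - apply is_lim_seq_minus'; apply is_lim_seq_mult'; assumption.
  - apply is_lim_seq_plus'; apply is_lim_seq_mult'; assumption.
Qed.

Lemma Cconv_inv (u : nat -> C) (l : C) : l <> 0 -> Cconv u l -> Cconv (fun n => / u n)%C (/ l)%C.
Proof.
  intros Hl [H1 H2].
  assert (D : Re l ^ 2 + Im l ^ 2 <> 0).
  { rewrite <- Cmod2_alt. apply pow_nonzero, Rgt_not_eq, Cmod_gt_0, Hl. }
  assert (H : is_lim_seq (fun n => Re (u n) ^ 2 + Im (u n) ^ 2) (Re l ^ 2 + Im l ^ 2)).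
  { simpl. apply is_lim_seq_plus'; apply is_lim_seq_mult'; try easy;
      apply is_lim_seq_mult'; try easy; apply is_lim_seq_const. }
  split.
  - exact (is_lim_seq_div' _ _ _ _ H1 H D).
  - refine (is_lim_seq_div' _ _ _ _ _ H D). exact (proj1 (is_lim_seq_opp _ _) H2).
Qed.

Lemma Cconv_RtoC (u : nat -> R) (l : R) : is_lim_seq u l -> Cconv (fun n => RtoC (u n)) (RtoC l).
Proof. intros H. split; [exact H | apply is_lim_seq_const]. Qed.

Lemma sum_n_le_series (a : nat -> R) (A : R) (n : nat) :
  (forall n, 0 <= a n) -> is_series a A -> sum_n a n <= A.
Proof.
  intros Ha HA. apply (is_lim_seq_incr_compare (sum_n a) A HA).
  intros m. rewrite sum_Sn. unfold plus; simpl. generalize (Ha (S m)); lra.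
Qed.

Fixpoint Cprod1 (u : nat -> C) (n : nat) : C :=
  match n with
  | O => RtoC 1
  | S m => (Cprod1 u m * (1 + u m))%C
  end.

(** Consecutive partial products differ by P_n u_n, so the infinite product is written as a
    telescoping series, to which [jet_bound_series] applies. *)
Definition Cprod1_lim (u : nat -> C) : C := (1 + CSeries (fun n => Cprod1 u n * u n))%C.

Lemma Cprod1_telescope (u : nat -> C) (s : C) :
  Csums (fun n => Cprod1 u n * u n)%C s -> Cconv (Cprod1 u) (1 + s)%C.
Proof.
  (* [sum_n] up to index [n] has [n + 1] terms and so matches the partial product of index [S n]. *)
  intros [H1 H2]. apply Cconv_incr_1. split.
  - apply is_lim_seq_ext with (fun n => 1 + sum_n (fun k => Re (Cprod1 u k * u k)%C) n).
    + intros n. induction n as [|n IH].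
      * rewrite sum_O. simpl. ring.
      * rewrite sum_Sn, <- Rplus_assoc, IH. simpl. ring.
    + apply is_lim_seq_plus'; [apply is_lim_seq_const | exact H1].
  - apply is_lim_seq_ext with (fun n => 0 + sum_n (fun k => Im (Cprod1 u k * u k)%C) n).
    + intros n. induction n as [|n IH].
      * rewrite sum_O. simpl. ring.
      * rewrite sum_Sn, <- Rplus_assoc, IH. simpl. ring.
    + apply is_lim_seq_plus'; [apply is_lim_seq_const | exact H2].
Qed.

Fixpoint Cprod1_deriv (u d : nat -> C) (n : nat) : C :=
  match n with
  | O => RtoC 0
  | S m => (Cprod1_deriv u d m * (1 + u m) + Cprod1 u m * d m)%C
  end.

(** A factor 1 + h_n has size at most 1 + a_n <= exp a_n, so submultiplicativity bounds all partial
    products by the exponential of the total, uniformly in [n]. *)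
Lemma jet_bound_Cprod1 (z : C) (r : R) (h : nat -> C -> C) (d : nat -> C) (a : nat -> R) (A : R) :
  0 < r -> (forall n, jet_bound z r (h n) (d n) (a n)) -> is_series a A ->
  forall n, jet_bound z r (fun w => Cprod1 (fun k => h k w) n)
    (Cprod1_deriv (fun k => h k z) d n) (exp A).
Proof.
  intros Hr H HA.
  assert (Ha : forall n, 0 <= a n) by (intros n; apply (jet_bound_pos _ _ _ _ _ (H n))).
  assert (A0 := sum_n_le_series a A 0 Ha HA). rewrite sum_O in A0. assert (Ha0 := Ha 0%nat).
  assert (step : forall n b, jet_bound z r (fun w => Cprod1 (fun k => h k w) n)
      (Cprod1_deriv (fun k => h k z) d n) (exp b) ->
    jet_bound z r (fun w => Cprod1 (fun k => h k w) (S n))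
      (Cprod1_deriv (fun k => h k z) d (S n)) (exp (b + a n))).
  { intros n b Hb.
    apply jet_bound_le with (exp b * (1 + a n)).
    - rewrite exp_plus. apply Rmult_le_compat_l; [left; apply exp_pos | apply exp_ineq1_le].
    - assert (H1 := jet_bound_plus _ _ _ _ _ _ _ _ (jet_bound_const z r 1) (H n)).
      rewrite Cmod_1, Cplus_0_l in H1.
      exact (jet_bound_mult _ _ _ _ _ _ _ _ Hr Hb H1). }
  (* [sum_n a m] includes the index [m], hence the separate value 0 for the empty product. *)
  assert (G : forall n, jet_bound z r (fun w => Cprod1 (fun k => h k w) n)
      (Cprod1_deriv (fun k => h k z) d n) (exp (match n with O => 0 | S m => sum_n a m end))).
  { assert (Z : jet_bound z r (fun w => Cprod1 (fun k => h k w) 0)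
      (Cprod1_deriv (fun k => h k z) d 0) (exp 0)).
    { rewrite exp_0, <- Cmod_1. apply jet_bound_const. }
    intros n. induction n as [|n IH]; [exact Z|].
    apply step in IH. destruct n as [|n].
    - rewrite sum_O. now rewrite Rplus_0_l in IH.
    - rewrite sum_Sn. exact IH. }
  intros n. apply jet_bound_le with (2 := G n). apply exp_le_exp.
  destruct n; [lra | now apply sum_n_le_series].
Qed.

(** The terms P_n h_n of the telescoping series have size at most [exp A * a n], which is
    summable. *)
Lemma Cprod1_lim_deriv (z : C) (r : R) (h : nat -> C -> C) (d : nat -> C) (a : nat -> R) :
  0 < r -> (forall n, jet_bound z r (h n) (d n) (a n)) -> ex_series a ->
  (forall w, Cmod (w - z) < r -> Cconv (Cprod1 (fun k => h k w)) (Cprod1_lim (fun k => h k w))) /\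
  exists D, Cderiv (fun w => Cprod1_lim (fun k => h k w)) z D.
Proof.
  intros Hr H [A HA].
  assert (G := jet_bound_Cprod1 z r h d a A Hr H HA).
  destruct (jet_bound_series z r (fun n w => Cprod1 (fun k => h k w) n * h n w)%C _
    (fun n => exp A * a n) Hr (fun n => jet_bound_mult _ _ _ _ _ _ _ _ Hr (G n) (H n))) as [S D].
  { exists (exp A * A). exact (is_series_scal _ _ _ HA). }
  split.
  - intros w Hw. apply Cprod1_telescope, S, Hw.
  - eexists.
    exact (Cderiv_comp (fun w => 1 + w)%C _ z _ _ (Cderiv_add_const _ _) D).
Qed.

Lemma Cprod1_neq_0 (u : nat -> C) (n : nat) : (forall k, (1 + u k)%C <> 0) -> Cprod1 u n <> 0.
Proof.
  intros H. induction n as [|n IH]; simpl; [exact C1_nz | now apply Cmult_neq_0].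
Qed.

(* Weierstrass: discarding finitely many factors, the sum of the [a n] is at
   most 1/2, and a product of [1 - a n] is at least [1 - sum a n]. *)
Lemma Cconv_Cprod1_neq_0 (u : nat -> C) (a : nat -> R) (L : C) :
  (forall n, (1 + u n)%C <> 0) -> (forall n, Cmod (u n) <= a n) -> ex_series a ->
  Cconv (Cprod1 u) L -> L <> 0.
Proof.
  intros Hnz Hu [A HA] HL.
  assert (Ha : forall n, 0 <= a n) by (intros n; apply Rle_trans with (2 := Hu n), Cmod_ge_0).
  destruct (proj1 (is_lim_seq_Reals _ _) HA (1 / 2)) as [N HN]; [lra|].
  specialize (HN N (Nat.le_refl N)).
  change (Rabs (sum_n a N - A) < 1 / 2) in HN.
  assert (HT : forall m, sum_n a (N + m) - sum_n a N <= 1 / 2).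
  { intros m. assert (H1 := sum_n_le_series a A (N + m) Ha HA).
    destruct (Rabs_def2 _ _ HN). lra. }
  assert (HP : forall m, 0 <= sum_n a (N + m) - sum_n a N).
  { intros m. induction m as [|m IH].
    - rewrite Nat.add_0_r. lra.
    - rewrite Nat.add_succ_r, sum_Sn. unfold plus; simpl. generalize (Ha (S (N + m))). lra. }
  set (c := Cmod (Cprod1 u (S N))).
  assert (Hc : 0 < c) by now apply Cmod_gt_0, Cprod1_neq_0.
  assert (Hm : forall m, c * (1 - (sum_n a (N + m) - sum_n a N)) <= Cmod (Cprod1 u (S N + m))).
  { intros m. induction m as [|m IH].
    - rewrite !Nat.add_0_r. fold c. lra.
    - assert (T := HT (S m)). assert (H0 := HP m).
      replace (S N + S m)%nat with (S (S N + m)) by lia.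
      replace (N + S m)%nat with (S (N + m)) in * by lia. rewrite sum_Sn in *.
      change (plus (sum_n a (N + m)) (a (S (N + m)))) with (sum_n a (N + m) + a (S (N + m))) in *.
      change (Cprod1 u (S (S N + m))) with (Cprod1 u (S N + m) * (1 + u (S (N + m))))%C.
      rewrite Cmod_mult.
      assert (Hb : 0 <= a (S (N + m))) by apply Ha.
      assert (H1 : 1 - a (S (N + m)) <= Cmod (1 + u (S (N + m)))).
      { assert (H2 := Cmod_triangle (1 + u (S (N + m))) (- u (S (N + m)))).
        replace (1 + u (S (N + m)) + - u (S (N + m)))%C with (RtoC 1) in H2 by ring.
        rewrite Cmod_1, Cmod_opp in H2. assert (H3 := Hu (S (N + m))). lra. }
      set (b := a (S (N + m))) in *. set (s := sum_n a (N + m) - sum_n a N) in *.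
      replace (sum_n a (N + m) + b - sum_n a N) with (s + b) in * by (unfold s; ring).
      apply Rle_trans with ((c * (1 - s)) * (1 - b)).
      + assert (0 <= c * (s * b)) by (apply Rmult_le_pos; nra). nra.
      + apply Rmult_le_compat; try lra. nra. }
  intros ->. destruct HL as [H1 H2].
  (* The squared modulus is a polynomial in the two parts, so a limit 0 would pass to it and
     contradict the lower bound (c/2)^2. *)
  assert (H : is_lim_seq (fun n => Re (Cprod1 u n) ^ 2 + Im (Cprod1 u n) ^ 2) (Re 0 ^ 2 + Im 0 ^ 2)).
  { simpl. apply is_lim_seq_plus'; apply is_lim_seq_mult'; try easy;
      apply is_lim_seq_mult'; try easy; apply is_lim_seq_const. }
  apply (is_lim_seq_incr_n _ (S N)) in H.
  assert (H3 : (c / 2) ^ 2 <= Re 0 ^ 2 + Im 0 ^ 2).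
  { apply (is_lim_seq_le (fun _ => (c / 2) ^ 2) _ (Finite _) (Finite _)) with (2 := is_lim_seq_const _) (3 := H).
    intros n. rewrite <- Cmod2_alt, Nat.add_comm. apply pow_incr.
    assert (H4 := Hm n). assert (H5 := HT n). nra. }
  simpl in H3. nra.
Qed.

(** * The gamma function *)

Lemma RtoC_neq_0 (x : R) : x <> 0 -> RtoC x <> 0.
Proof. intros H E. apply H. now injection E. Qed.

Lemma ln_le_sub_one (x : R) : 0 < x -> ln x <= x - 1.
Proof. intros Hx. generalize (exp_ineq1_le (ln x)). rewrite exp_ln by easy. lra. Qed.

(** The terms telescope as 1/m - 1/(m + 1). This is the comparison series for the factors of
    1/Gamma. *)
Lemma ex_series_inv_mul_succ : ex_series (fun n => / (INR (S n) * INR (S (S n)))).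
Proof.
  exists 1.
  change (is_lim_seq (sum_n (fun n => / (INR (S n) * INR (S (S n))))) 1).
  apply (is_lim_seq_ext (fun n => 1 - / INR (S (S n)))).
  - intros n. induction n as [|n IH].
    + rewrite sum_O. change (1 - / (1 + 1) = / (1 * (1 + 1))). field.
    + rewrite sum_Sn, <- IH.
      change (1 - / INR (S (S (S n))) = 1 - / INR (S (S n)) + / (INR (S (S n)) * INR (S (S (S n))))).
      rewrite !S_INR. field. assert (H := pos_INR n). repeat split; lra.
  - replace (Finite 1) with (Finite (1 - 0)) by (f_equal; ring).
    apply is_lim_seq_minus'; [apply is_lim_seq_const|].
    apply -> (is_lim_seq_incr_1 (fun n => / INR (S n))).
    apply -> (is_lim_seq_incr_1 (fun n => / INR n)).
    replace (Finite 0) with (Rbar_inv p_infty) by reflexivity.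
    apply is_lim_seq_inv; [apply is_lim_seq_INR | easy].
Qed.

(** The value is O(lam^2) by Taylor's bound. The first-order remainder at [z] is [Cexp (z * - lam)]
    times the same expression taken at [w - z], so Taylor's bound applies again. The constant must
    not depend on [lam], which later tends to 0. *)
Lemma jet_bound_Cexp_remainder (z : C) (r : R) : 0 < r ->
  exists K, 0 <= K /\ forall lam, 0 <= lam <= 1 ->
    jet_bound z r (fun w => Cexp (w * - lam) - 1 + w * lam)%C
      (- lam * (Cexp (z * - lam) - 1))%C (K * lam ^ 2).
Proof.
  intros Hr.
  assert (Hz := Cmod_ge_0 z). set (L := Cmod z + r). set (E := exp L).
  assert (HE : 0 < E) by apply exp_pos.
  assert (bnd : forall s lam, 0 <= lam <= 1 -> Cmod s <= L ->
    Cmod (Cexp (s * - lam) - 1 + s * lam) <= 4 * E * lam ^ 2 * Cmod s ^ 2).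
  { intros s lam Hl Hs.
    replace (_ - _ + _)%C with (Cexp (s * - lam) - 1 - (s * - lam))%C by ring.
    apply Rle_trans with (1 := Cexp_taylor1_le _).
    rewrite Cmod_mult, Cmod_opp, Cmod_R, Rabs_pos_eq by lra.
    assert (H0 := Cmod_ge_0 s).
    assert (H1 : exp (Cmod s * lam) <= E) by (apply exp_le_exp; nra).
    replace (4 * E * lam ^ 2 * Cmod s ^ 2) with (4 * (Cmod s * lam) ^ 2 * E) by ring.
    apply Rmult_le_compat_l; [|easy]. apply Rmult_le_pos; [lra | apply pow2_ge_0]. }
  (* [L] bounds |w| on the disc. In [be], the part without [r] bounds the derivative at [z], and
     [ga * r] turns the quadratic remainder into a linear one by |w - z| < r. *)
  set (al := 4 * E * L ^ 2). set (ga := E * (4 * E)). set (be := L + 4 * E * L ^ 2 + ga * r).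
  assert (HL : 0 <= L) by (unfold L; lra). assert (HL2 := pow2_ge_0 L).
  assert (Hal : 0 <= al) by (unfold al; nra).
  assert (Hga : 0 <= ga) by (unfold ga; nra).
  assert (Hbe : L + 4 * E * L ^ 2 <= be) by (unfold be; nra).
  assert (Hbe0 : 0 <= be) by (unfold al in Hal; lra).
  exists (al + be + ga). split; [lra|].
  intros lam Hl. assert (Hl2 := pow2_ge_0 lam).
  assert (Hd : Cmod (- lam * (Cexp (z * - lam) - 1)) <= (L + 4 * E * L ^ 2) * lam ^ 2).
  { rewrite Cmod_mult, Cmod_opp, Cmod_R, Rabs_pos_eq by lra.
    replace (Cexp (z * - lam) - 1)%C with ((Cexp (z * - lam) - 1 + z * lam) + z * - lam)%C by ring.
    assert (H1 := Cmod_triangle (Cexp (z * - lam) - 1 + z * lam) (z * - lam)).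
    rewrite (Cmod_mult z), Cmod_opp, Cmod_R, Rabs_pos_eq in H1 by lra.
    assert (H2 := bnd z lam Hl ltac:(unfold L; lra)).
    assert (H3 : 4 * E * lam ^ 2 * Cmod z ^ 2 <= 4 * E * lam * L ^ 2).
    { assert (Cmod z ^ 2 <= L ^ 2) by (apply pow_incr; unfold L; lra).
      assert (0 <= Cmod z ^ 2) by apply pow2_ge_0.
      assert (lam ^ 2 <= lam) by nra.
      apply Rmult_le_compat; try lra; [nra|]. apply Rmult_le_compat_l; lra. }
    replace ((L + 4 * E * L ^ 2) * lam ^ 2) with (lam * (4 * E * lam * L ^ 2 + L * lam)) by ring.
    apply Rmult_le_compat_l; [lra|].
    assert (Cmod z * lam <= L * lam) by (unfold L; nra). lra. }
  exists (al * lam ^ 2), (be * lam ^ 2), (ga * lam ^ 2).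
  split; [nra|]. split; [nra|]. split; [nra|]. split; [lra|]. split; [nra|].
  intros w Hw.
  assert (Hwz := Cmod_ge_0 (w - z)).
  assert (HwL : Cmod w <= L).
  { assert (H1 := Cmod_triangle (w - z) z). replace (w - z + z)%C with w in H1 by ring. unfold L; lra. }
  assert (Hsec : Cmod ((Cexp (w * - lam) - 1 + w * lam) - (Cexp (z * - lam) - 1 + z * lam)
      - (- lam * (Cexp (z * - lam) - 1)) * (w - z)) <= ga * lam ^ 2 * Cmod (w - z) ^ 2).
  { replace (Cexp (w * - lam)) with (Cexp (z * - lam) * Cexp ((w - z) * - lam))%C
      by (rewrite <- Cexp_add; f_equal; ring).
    replace (_ - _ - _)%C with (Cexp (z * - lam) * (Cexp ((w - z) * - lam) - 1 + (w - z) * lam))%C by ring.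
    rewrite Cmod_mult.
    replace (ga * lam ^ 2 * Cmod (w - z) ^ 2) with (E * (4 * E * lam ^ 2 * Cmod (w - z) ^ 2))
      by (unfold ga; ring).
    apply Rmult_le_compat; try apply Cmod_ge_0.
    - apply Rle_trans with (1 := Cmod_Cexp_le _). apply exp_le_exp.
      rewrite Cmod_mult, Cmod_opp, Cmod_R, Rabs_pos_eq by lra. unfold L. nra.
    - apply bnd; [easy | unfold L; lra]. }
  split; [|split; [|exact Hsec]].
  - apply Rle_trans with (1 := bnd w lam Hl HwL). unfold al.
    replace (4 * E * L ^ 2 * lam ^ 2) with (4 * E * lam ^ 2 * L ^ 2) by ring.
    apply Rmult_le_compat_l; [nra|]. apply pow_incr. split; [apply Cmod_ge_0 | easy].
  - set (d := (- lam * (Cexp (z * - lam) - 1))%C) in *.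
    set (A := (Cexp (w * - lam) - 1 + w * lam)%C) in *. set (B := (Cexp (z * - lam) - 1 + z * lam)%C) in *.
    replace (A - B)%C with ((A - B - d * (w - z)) + d * (w - z))%C by ring.
    apply Rle_trans with (1 := Cmod_triangle _ _). rewrite (Cmod_mult d).
    set (m := Cmod (w - z)) in *.
    assert (ga * lam ^ 2 * m ^ 2 <= ga * r * lam ^ 2 * m).
    { replace (ga * lam ^ 2 * m ^ 2) with ((ga * lam ^ 2 * m) * m) by ring.
      replace (ga * r * lam ^ 2 * m) with ((ga * lam ^ 2 * m) * r) by ring.
      apply Rmult_le_compat_l; [|lra]. apply Rmult_le_pos; nra. }
    assert (Cmod d * m <= (L + 4 * E * L ^ 2) * lam ^ 2 * m) by (apply Rmult_le_compat_r; lra).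
    unfold be. nra.
Qed.

Definition log_step (n : nat) : R := ln (INR (S (S n))) - ln (INR (S n)).

(** Both bounds are ln y <= y - 1, at y = m/(m + 1) and at y = (m + 1)/m with m = n + 1. *)
Lemma log_step_bounds (n : nat) : / INR (S (S n)) <= log_step n <= / INR (S n).
Proof.
  unfold log_step. assert (H1 : 0 < INR (S n)) by apply lt_0_INR, Nat.lt_0_succ.
  rewrite (S_INR (S n)). set (m := INR (S n)) in *.
  split.
  - assert (H := ln_le_sub_one (m / (m + 1)) ltac:(apply Rdiv_lt_0_compat; lra)).
    rewrite ln_div in H by lra.
    replace (m / (m + 1) - 1) with (- / (m + 1)) in H by (field; lra). lra.
  - assert (H := ln_le_sub_one ((m + 1) / m) ltac:(apply Rdiv_lt_0_compat; lra)).
    rewrite ln_div in H by lra.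
    replace ((m + 1) / m - 1) with (/ m) in H by (field; lra). lra.
Qed.

(* [1 + gamma_factor n z] is the ratio of the terms of index [n + 2] and [n + 1]
   in Euler's limit for [1 / Gamma z]. *)
Definition gamma_factor (n : nat) (z : C) : C :=
  ((1 + z * / INR (S (S n))) * Cexp (z * - log_step n) - 1)%C.

(** With t = 1/(n + 2) and lam = [log_step n], the factor is w (t - lam) - w^2 t lam + (1 + w t)
    (exp(-lam w) - 1 + lam w). Neither t nor lam is summable, but |t - lam|, t lam and lam^2 are all
    O(1/((n + 1)(n + 2))). *)
Lemma jet_bound_gamma_factor (z : C) (r : R) : 0 < r ->
  exists K (d : nat -> C), forall n,
    jet_bound z r (gamma_factor n) (d n) (K * / (INR (S n) * INR (S (S n)))).
Proof.
  intros Hr. destruct (jet_bound_Cexp_remainder z r Hr) as [K [HK HE]].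
  set (L := Cmod z + r + 1).
  assert (Hid := jet_bound_id z r Hr). fold L in Hid.
  assert (HL : 0 <= L) by (generalize (Cmod_ge_0 z); unfold L; lra).
  (* A [sig] rather than an [exists], so that the derivatives form a sequence without a choice
     principle. *)
  assert (H : forall n, { d | jet_bound z r (gamma_factor n) d
    ((L + L * L + (1 + L) * (2 * K)) * / (INR (S n) * INR (S (S n)))) }).
  { intros n. set (t := / INR (S (S n))). set (lam := log_step n).
    destruct (log_step_bounds n) as [Hl1 Hl2]. fold lam in Hl1, Hl2. fold t in Hl1.
    set (q := / (INR (S n) * INR (S (S n)))).
    assert (Hn : 1 <= INR (S n)) by (rewrite S_INR; generalize (pos_INR n); lra).
    assert (Ht : 0 < t) by (apply Rinv_0_lt_compat, lt_0_INR, Nat.lt_0_succ).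
    assert (Hs1 : / INR (S n) <= 1) by (rewrite <- Rinv_1; apply Rinv_le_contravar; lra).
    assert (Hs : 0 <= / INR (S n)) by lra.
    assert (Hq : q = / INR (S n) * t) by (unfold q, t; apply Rinv_mult).
    assert (Hq' : / INR (S n) - t = q) by (unfold q, t; rewrite (S_INR (S n)); field; lra).
    assert (Hst : / INR (S n) <= 2 * t).
    { unfold t. rewrite (S_INR (S n)).
      apply Rmult_le_reg_r with (INR (S n) * (INR (S n) + 1)); [nra|].
      field_simplify; lra. }
    assert (B1 : Cmod (t - lam)%C <= q).
    { rewrite <- RtoC_minus, Cmod_R. apply Rabs_le. lra. }
    assert (B2 : Cmod (- (t * lam))%C <= q).
    { rewrite Cmod_opp, <- RtoC_mult, Cmod_R, Rabs_pos_eq by nra. rewrite Hq. nra. }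
    assert (B3 : lam ^ 2 <= 2 * q) by (rewrite Hq; nra).
    assert (B4 : Cmod (RtoC t) <= 1) by (rewrite Cmod_R, Rabs_pos_eq; lra).
    assert (J1 := jet_bound_mult _ _ _ _ _ _ _ _ Hr Hid
      (jet_bound_le _ _ _ _ _ _ B1 (jet_bound_const z r (t - lam)%C))).
    assert (J2 := jet_bound_mult _ _ _ _ _ _ _ _ Hr (jet_bound_mult _ _ _ _ _ _ _ _ Hr Hid Hid)
      (jet_bound_le _ _ _ _ _ _ B2 (jet_bound_const z r (- (t * lam))%C))).
    assert (J3 := jet_bound_plus _ _ _ _ _ _ _ _ (jet_bound_const z r 1)
      (jet_bound_mult _ _ _ _ _ _ _ _ Hr Hid
        (jet_bound_le _ _ _ _ _ _ B4 (jet_bound_const z r t)))).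
    assert (J4 := jet_bound_mult _ _ _ _ _ _ _ _ Hr J3
      (jet_bound_le _ _ _ _ _ _ (Rmult_le_compat_l _ _ _ HK B3) (HE lam ltac:(lra)))).
    assert (J := jet_bound_plus _ _ _ _ _ _ _ _ (jet_bound_plus _ _ _ _ _ _ _ _ J1 J2) J4).
    eexists. eapply jet_bound_le; [|eapply jet_bound_ext; [|reflexivity|exact J]].
    - rewrite Cmod_1. apply Req_le. ring.
    - intros w. unfold gamma_factor. rewrite <- RtoC_inv by (apply not_0_INR; discriminate).
      fold t lam. ring. }
  exists (L + L * L + (1 + L) * (2 * K)), (fun n => proj1_sig (H n)).
  intros n. exact (proj2_sig (H n)).
Qed.

Lemma Cprod1_gamma_deriv (z : C) :
  Cconv (Cprod1 (fun n => gamma_factor n z)) (Cprod1_lim (fun n => gamma_factor n z)) /\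
  exists D, Cderiv (fun w => Cprod1_lim (fun n => gamma_factor n w)) z D.
Proof.
  destruct (jet_bound_gamma_factor z 1 Rlt_0_1) as [K [d H]].
  assert (E : ex_series (fun n => K * / (INR (S n) * INR (S (S n)))))
    by exact (ex_series_scal (V := R_NormedModule) K _ ex_series_inv_mul_succ).
  destruct (Cprod1_lim_deriv z 1 _ d _ Rlt_0_1 H E) as [H1 H2].
  split; [|exact H2]. apply H1. replace (z - z)%C with (RtoC 0) by ring. rewrite Cmod_0; lra.
Qed.

Lemma INR_C_neq_0 (n : nat) : RtoC (INR (S n)) <> 0.
Proof. apply RtoC_neq_0, not_0_INR. discriminate. Qed.

Lemma Cprod1_gamma_lim_neq_0 (z : C) :
  (forall n, (z + INR n)%C <> 0) -> Cprod1_lim (fun n => gamma_factor n z) <> 0.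
Proof.
  intros Hz. destruct (jet_bound_gamma_factor z 1 Rlt_0_1) as [K [d H]].
  apply (Cconv_Cprod1_neq_0 (fun n => gamma_factor n z) (fun n => K * / (INR (S n) * INR (S (S n))))).
  - intros n. unfold gamma_factor.
    replace (1 + (_ - 1))%C with ((z + INR (S (S n))) * / INR (S (S n)) * Cexp (z * - log_step n))%C
      by (field; apply INR_C_neq_0).
    apply Cmult_neq_0; [|apply Cexp_neq_0].
    apply Cmult_neq_0; [apply Hz|]. rewrite <- RtoC_inv by (apply not_0_INR; discriminate).
    apply RtoC_neq_0, Rinv_neq_0_compat, not_0_INR; discriminate.
  - intros n. apply (jet_bound_Cmod _ _ _ _ _ (H n)).
    replace (z - z)%C with (RtoC 0) by ring. rewrite Cmod_0; lra.
  - exact (ex_series_scal (V := R_NormedModule) K _ ex_series_inv_mul_succ).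
  - apply Cprod1_gamma_deriv.
Qed.

(** * Euler's limit as the reciprocal of the product *)

Lemma Cln_pos (x : R) : 0 < x -> Cln x = RtoC (ln x).
Proof.
  intros Hx. unfold Cln, Carg. rewrite Cmod_R, Rabs_pos_eq by lra. simpl.
  destruct (Rle_dec 0 0) as [_ | H]; [|lra].
  replace (x / x) with 1 by (field; lra). now rewrite acos_1.
Qed.

Lemma Cpower_neq_0 (z a : C) : z <> 0 -> Cpower z a = Cexp (a * Cln z).
Proof. intros Hz. unfold Cpower. now destruct (Ceq_dec z 0). Qed.

Lemma Cpower_INR (n : nat) (a : C) : Cpower (INR (S n)) a = Cexp (a * ln (INR (S n))).
Proof.
  rewrite Cpower_neq_0 by apply INR_C_neq_0. rewrite Cln_pos; [easy|].
  apply lt_0_INR, Nat.lt_0_succ.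
Qed.

Lemma pochhammer_neq_0 (a : C) (n : nat) :
  (forall k, (a + INR k)%C <> 0) -> pochhammer a n <> 0.
Proof.
  intros H. induction n as [|n IH]; simpl; [exact C1_nz | now apply Cmult_neq_0].
Qed.

Lemma pochhammer_succ_l (a : C) (n : nat) :
  pochhammer a (S n) = (a * pochhammer (a + 1) n)%C.
Proof.
  induction n as [|n IH]; [simpl; ring|].
  change (pochhammer a (S (S n))) with (pochhammer a (S n) * (a + INR (S n)))%C.
  rewrite IH. change (pochhammer (a + 1) (S n)) with (pochhammer (a + 1) n * (a + 1 + INR n))%C.
  rewrite S_INR, RtoC_plus. ring.
Qed.

(** The product starts from the term of index 1 in Euler's limit, whose reciprocal is [z * (z + 1)];
    the term of index 0 contains a power of 0. *)
Lemma pochhammer_Cprod1 (z : C) (n : nat) :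
  pochhammer z (S (S n)) =
  (INR (fact (S n)) * Cpower (INR (S n)) z * (z * (z + 1) * Cprod1 (fun k => gamma_factor k z) n))%C.
Proof.
  induction n as [|n IH].
  - rewrite Cpower_INR. simpl. rewrite ln_1. replace (z * 0)%C with (RtoC 0) by ring. rewrite Cexp_0. ring.
  - change (pochhammer z (S (S (S n)))) with (pochhammer z (S (S n)) * (z + INR (S (S n))))%C.
    rewrite IH, !Cpower_INR.
    change (fact (S (S n))) with (S (S n) * fact (S n))%nat.
    rewrite mult_INR, RtoC_mult. simpl Cprod1. unfold gamma_factor at 3.
    assert (E : Cexp (z * ln (INR (S n))) = (Cexp (z * ln (INR (S (S n)))) * Cexp (z * - log_step n))%C).
    { rewrite <- Cexp_add. f_equal. unfold log_step. rewrite RtoC_minus. ring. }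
    rewrite E. field. apply INR_C_neq_0.
Qed.

Definition nonpole (z : C) : Prop := forall n, (z + INR n)%C <> 0.

Lemma nonpole_neq_0 (z : C) : nonpole z -> z <> 0.
Proof. intros H. generalize (H 0%nat). simpl. now rewrite Cplus_0_r. Qed.

Lemma nonpole_succ (z : C) : nonpole z -> nonpole (z + 1).
Proof.
  intros H n. generalize (H (S n)). rewrite S_INR, RtoC_plus.
  now replace (z + (INR n + 1))%C with (z + 1 + INR n)%C by ring.
Qed.

Definition gamma_seq (z : C) (n : nat) : C :=
  (INR (fact n) * Cpower (INR n) z / pochhammer z (S n))%C.

(** 1/Gamma as an infinite product, differentiable at every point; Gamma is then differentiated as
    its reciprocal. *)
Definition recip_gamma (z : C) : C := (z * (z + 1) * Cprod1_lim (fun n => gamma_factor n z))%C.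

Lemma recip_gamma_neq_0 (z : C) : nonpole z -> recip_gamma z <> 0.
Proof.
  intros Hz. unfold recip_gamma.
  apply Cmult_neq_0; [apply Cmult_neq_0 | now apply Cprod1_gamma_lim_neq_0].
  - now apply nonpole_neq_0.
  - now apply nonpole_neq_0, nonpole_succ.
Qed.

Lemma Cconv_gamma_seq (z : C) : nonpole z -> Cconv (gamma_seq z) (/ recip_gamma z)%C.
Proof.
  intros Hz. apply Cconv_incr_1.
  apply Cconv_ext with (fun n => / (z * (z + 1) * Cprod1 (fun k => gamma_factor k z) n))%C.
  - intros n. unfold gamma_seq. rewrite pochhammer_Cprod1, Cpower_INR.
    assert (H := pochhammer_neq_0 z (S (S n)) Hz). rewrite pochhammer_Cprod1, Cpower_INR in H.
    assert (H1 : RtoC (INR (fact (S n))) <> 0) by apply RtoC_neq_0, INR_fact_neq_0.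
    assert (H2 := Cexp_neq_0 (z * ln (INR (S n)))).
    set (A := RtoC (INR (fact (S n)))) in *. set (B := Cexp (z * ln (INR (S n)))) in *.
    set (P := (z * (z + 1) * Cprod1 (fun k => gamma_factor k z) n)%C) in *.
    assert (P <> 0) by (intros E; apply H; rewrite E; ring).
    field. auto.
  - apply Cconv_inv; [now apply recip_gamma_neq_0|].
    apply Cconv_mult; [apply Cconv_const | apply Cprod1_gamma_deriv].
Qed.

Lemma CGamma_eq (z : C) : nonpole z -> CGamma z = (/ recip_gamma z)%C.
Proof. intros Hz. exact (Cconv_CLim_seq _ _ (Cconv_gamma_seq z Hz)). Qed.

Lemma CGamma_neq_0 (z : C) : nonpole z -> CGamma z <> 0.
Proof.
  intros Hz. rewrite CGamma_eq by easy. intros E.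
  apply C1_nz. rewrite <- (Cinv_r (recip_gamma z)) by now apply recip_gamma_neq_0.
  rewrite E. ring.
Qed.

(** The terms of index m >= 1 in the two Euler limits have ratio z m / (z + 1 + m), that is z / (1 +
    (z + 1)/m), which tends to z. *)
Lemma CGamma_succ (z : C) : nonpole z -> CGamma (z + 1) = (z * CGamma z)%C.
Proof.
  intros Hz. assert (Hz1 := nonpole_succ z Hz).
  rewrite (CGamma_eq z) by easy. apply Cconv_CLim_seq. fold (gamma_seq (z + 1)).
  apply (Cconv_incr_1 (gamma_seq (z + 1))).
  apply Cconv_ext with (fun n => z * gamma_seq z (S n) * / (1 + (z + 1) * / INR (S n)))%C.
  - intros n. unfold gamma_seq.
    assert (Hp := pochhammer_neq_0 z (S (S (S n))) Hz).
    assert (E : pochhammer z (S (S (S n))) = (pochhammer z (S (S n)) * (z + INR (S (S n))))%C) by reflexivity.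
    assert (F := pochhammer_succ_l z (S (S n))).
    assert (H0 := nonpole_neq_0 z Hz). assert (H2 := Hz (S (S n))).
    assert (H1 := pochhammer_neq_0 z (S (S n)) Hz). assert (H3 := pochhammer_neq_0 _ (S (S n)) Hz1).
    assert (G : pochhammer (z + 1) (S (S n)) = (pochhammer z (S (S n)) * (z + INR (S (S n))) / z)%C).
    { rewrite <- E, F. field. easy. }
    rewrite G. rewrite !Cpower_INR.
    replace (Cexp ((z + 1) * ln (INR (S n)))) with (Cexp (z * ln (INR (S n))) * INR (S n))%C.
    2:{ rewrite <- (exp_ln (INR (S n))) at 2 by apply lt_0_INR, Nat.lt_0_succ.
        rewrite <- Cexp_RtoC, <- Cexp_add. f_equal. ring. }
    rewrite (S_INR (S n)), RtoC_plus in *.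
    assert (H4 := INR_C_neq_0 n).
    field. repeat split; auto.
  - assert (K : Cconv (fun n => 1 + (z + 1) * / INR (S n))%C (1 + (z + 1) * 0)%C).
    { apply Cconv_plus; [apply Cconv_const|]. apply Cconv_mult; [apply Cconv_const|].
      apply Cconv_ext with (fun n => RtoC (/ INR (S n))); [intros n; apply RtoC_inv, not_0_INR; discriminate|].
      apply Cconv_RtoC. apply -> (is_lim_seq_incr_1 (fun n => / INR n)).
      replace (Finite 0) with (Rbar_inv p_infty) by reflexivity.
      apply is_lim_seq_inv; [apply is_lim_seq_INR | easy]. }
    replace (1 + (z + 1) * 0)%C with (RtoC 1) in K by ring.
    replace (z * / recip_gamma z)%C with (z * / recip_gamma z * / 1)%C by (field; now apply recip_gamma_neq_0).
    apply Cconv_mult; [|apply Cconv_inv; [exact C1_nz | exact K]].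
    apply Cconv_mult; [apply Cconv_const|].
    now apply Cconv_incr_1, Cconv_gamma_seq.
Qed.

Lemma CGamma_add_INR (z : C) (n : nat) :
  nonpole z -> CGamma (z + INR n) = (pochhammer z n * CGamma z)%C.
Proof.
  intros Hz. induction n as [|n IH]; [simpl; rewrite Cplus_0_r; ring|].
  rewrite S_INR, RtoC_plus, Cplus_assoc, CGamma_succ, IH.
  - simpl. ring.
  - intros k. generalize (Hz (n + k)%nat). rewrite plus_INR, RtoC_plus. now rewrite Cplus_assoc.
Qed.

(** For n > |z| + 1 the modulus exceeds 1; the remaining indices are finitely many and a minimum
    exists. Taking [m <= 1] makes one bound serve both ranges. *)
Lemma nonpole_dist (z : C) : nonpole z -> exists m, 0 < m <= 1 /\ forall n, m <= Cmod (z + INR n).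
Proof.
  intros Hz.
  assert (F : forall N, exists m, 0 < m <= 1 /\ forall n, (n < N)%nat -> m <= Cmod (z + INR n)).
  { induction N as [|N [m [Hm IH]]]; [exists 1; split; [lra | lia]|].
    exists (Rmin m (Cmod (z + INR N))). split.
    - split; [apply Rmin_pos; [easy | apply Cmod_gt_0, Hz]|].
      apply Rle_trans with (1 := Rmin_l _ _). easy.
    - intros n Hn. destruct (Nat.eq_dec n N) as [-> | Hne]; [apply Rmin_r|].
      apply Rle_trans with (1 := Rmin_l _ _), IH. lia. }
  destruct (INR_unbounded (Cmod z + 1)) as [N HN].
  destruct (F N) as [m [Hm Hlt]]. exists m. split; [easy|].
  intros n. destruct (Nat.lt_ge_cases n N) as [H | H]; [now apply Hlt|].
  apply le_INR in H.
  assert (T := Cmod_triangle (z + INR n) (- z)). rewrite Cmod_opp in T.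
  replace (z + INR n + - z)%C with (RtoC (INR n)) in T by ring.
  rewrite Cmod_R, Rabs_pos_eq in T by apply pos_INR. lra.
Qed.

(** A single radius and a single lower bound for all [n]: the jets of all 1/(w + n) live on one
    disc. *)
Lemma nonpole_open (z : C) : nonpole z ->
  exists m, 0 < m <= 1 /\ forall w, Cmod (w - z) < m -> forall n, m <= Cmod (w + INR n).
Proof.
  intros Hz. destruct (nonpole_dist z Hz) as [m [Hm H]].
  exists (m / 2). split; [lra|]. intros w Hw n.
  assert (T := Cmod_triangle (w + INR n) (- (w - z))). rewrite Cmod_opp in T.
  replace (w + INR n + - (w - z))%C with (z + INR n)%C in T by ring.
  generalize (H n). lra.
Qed.

Lemma Cderiv_CGamma (z : C) : nonpole z -> exists D, Cderiv CGamma z D.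
Proof.
  intros Hz. destruct (Cprod1_gamma_deriv z) as [_ [D HD]].
  destruct (nonpole_open z Hz) as [m [Hm Hw]].
  eexists. apply (Cderiv_ext_loc (fun w => / recip_gamma w)%C _ _ _ m); [easy | |].
  - intros w Hwz. symmetry. apply CGamma_eq. intros n. apply Cmod_gt_0.
    generalize (Hw w Hwz n). lra.
  - apply Cderiv_inv; [now apply recip_gamma_neq_0|]. unfold recip_gamma.
    apply Cderiv_mult; [|exact HD].
    apply Cderiv_mult; [exact (Cderiv_ext_loc _ _ _ _ 1 Rlt_0_1 (fun w _ => Cmult_1_r w) (Cderiv_mul_const 1 z))|].
    exact (Cderiv_ext_loc _ _ _ _ 1 Rlt_0_1 (fun w _ => Cplus_comm 1 w) (Cderiv_add_const 1 z)).
Qed.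

(** * The series 0F1 and Kummer's second transformation *)

(** Zero factors are covered through [/ 0 = 0]. This matters because [jet_bound_ext] asks for
    equality at every [w], poles included. *)
Lemma Cinv_mul (a b : C) : (/ (a * b) = / a * / b)%C.
Proof.
  assert (H0 : (/ 0)%C = RtoC 0) by (unfold Cinv, RtoC; simpl; f_equal; unfold Rdiv; ring).
  destruct (Ceq_dec a 0) as [-> | Ha]; [rewrite Cmult_0_l, H0; ring|].
  destruct (Ceq_dec b 0) as [-> | Hb]; [rewrite Cmult_0_r, H0; ring|].
  field. auto.
Qed.

Definition hyp0F1 (c : C) (y : R) : C :=
  CSeries (fun n => y ^ n / (INR (fact n) * pochhammer c n))%C.

Lemma ex_series_exp (y : R) : ex_series (fun n => / INR (fact n) * y ^ n).
Proof. apply ex_pseries_R. exists (exp y). apply is_exp_Reals. Qed.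

(** Every 1/(w + n) has size at most [B] on the common disc, so the n-th term has size at most (|y|
    B)^n / n! and the exponential series dominates. The absolute summability is for the Cauchy
    product with exp(x/2). *)
Lemma hyp0F1_deriv (c : C) (y : R) : nonpole c ->
  ex_series (fun n => Cmod (y ^ n / (INR (fact n) * pochhammer c n))) /\
  exists D, Cderiv (fun w => hyp0F1 w y) c D.
Proof.
  intros Hc. destruct (nonpole_open c Hc) as [m [Hm Hw]].
  assert (Hr : 0 < m) by lra.
  set (B := / m + (/ m) ^ 2 + (/ m) ^ 3).
  assert (J : forall n, {d | jet_bound c m (fun w => / pochhammer w n)%C d (B ^ n)}).
  { induction n as [|n [d IH]].
    - exists 0. rewrite pow_O, <- Cmod_1.
      apply jet_bound_ext with (3 := jet_bound_const c m 1); [|easy].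
      intros w. simpl. field.
    - assert (H : forall w, Cmod (w - c) < m -> (w + INR n)%C <> 0 /\ / Cmod (w + INR n) <= / m).
      { intros w Hwc. assert (H := Hw w Hwc n). split; [apply Cmod_gt_0; lra|].
        apply Rinv_le_contravar; lra. }
      assert (I := jet_bound_mult _ _ _ _ _ _ _ _ Hr IH (jet_bound_inv_add c m (INR n) (/ m) Hr H)).
      fold B in I. eexists. simpl pow. rewrite Rmult_comm.
      eapply jet_bound_ext; [|reflexivity|exact I].
      intros w. simpl. now rewrite Cinv_mul. }
  assert (T : forall n, {d | jet_bound c m (fun w => y ^ n / (INR (fact n) * pochhammer w n))%C d
      (/ INR (fact n) * (Rabs y * B) ^ n)}).
  { intros n. destruct (J n) as [d H].
    assert (I := jet_bound_mult _ _ _ _ _ _ _ _ Hr (jet_bound_const c m (y ^ n * / INR (fact n))%C) H).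
    eexists. eapply jet_bound_le; [|eapply jet_bound_ext; [|reflexivity|exact I]].
    - rewrite Cmod_mult, Cmod_pow, Cmod_R, <- RtoC_inv, Cmod_R by apply INR_fact_neq_0.
      rewrite (Rabs_pos_eq (/ _)) by (left; apply Rinv_0_lt_compat, INR_fact_lt_0).
      rewrite Rpow_mult_distr. apply Req_le. ring.
    - intros w. unfold Cdiv. rewrite Cinv_mul. ring. }
  destruct (jet_bound_series c m _ (fun n => proj1_sig (T n)) _ Hr (fun n => proj2_sig (T n))
    (ex_series_exp _)) as [H1 H2].
  split; [|eexists; exact H2].
  apply (ex_series_le (K := R_AbsRing) (V := R_CompleteNormedModule)) with (2 := ex_series_exp (Rabs y * B)).
  intros n. change (Rabs (Cmod (y ^ n / (INR (fact n) * pochhammer c n))) <= / INR (fact n) * (Rabs y * B) ^ n).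
  rewrite Rabs_pos_eq by apply Cmod_ge_0.
  apply (jet_bound_Cmod _ _ _ _ _ (proj2_sig (T n))).
  replace (c - c)%C with (RtoC 0) by ring. rewrite Cmod_0; lra.
Qed.

(** * Taylor coefficients of a product with exp(x/2) *)

Fixpoint Csum (f : nat -> C) (n : nat) : C :=
  match n with
  | O => f O
  | S m => (Csum f m + f (S m))%C
  end.

Lemma Csum_S (f : nat -> C) (n : nat) : Csum f (S n) = (Csum f n + f (S n))%C.
Proof. reflexivity. Qed.

Lemma Csum_ext (f g : nat -> C) (n : nat) :
  (forall k, (k <= n)%nat -> f k = g k) -> Csum f n = Csum g n.
Proof.
  induction n as [|n IH]; intros H; simpl; [apply H; lia|].
  rewrite IH, H; [easy | lia | intros; apply H; lia].
Qed.

Lemma Csum_plus (f g : nat -> C) (n : nat) : Csum (fun k => f k + g k)%C n = (Csum f n + Csum g n)%C.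
Proof. induction n as [|n IH]; simpl; [easy|]. rewrite IH. ring. Qed.

Lemma Csum_scal (c : C) (f : nat -> C) (n : nat) : Csum (fun k => c * f k)%C n = (c * Csum f n)%C.
Proof. induction n as [|n IH]; simpl; [easy|]. rewrite IH. ring. Qed.

Lemma Csum_shift (f : nat -> C) (n : nat) : Csum f (S n) = (f O + Csum (fun k => f (S k)) n)%C.
Proof.
  induction n as [|n IH]; [easy|].
  change (Csum f (S (S n))) with (Csum f (S n) + f (S (S n)))%C. rewrite IH. simpl. ring.
Qed.

Lemma Re_Csum (f : nat -> C) (n : nat) : Re (Csum f n) = sum_f_R0 (fun k => Re (f k)) n.
Proof. induction n as [|n IH]; simpl; [easy|]. now rewrite <- IH. Qed.

Lemma Im_Csum (f : nat -> C) (n : nat) : Im (Csum f n) = sum_f_R0 (fun k => Im (f k)) n.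
Proof. induction n as [|n IH]; simpl; [easy|]. now rewrite <- IH. Qed.

Definition half_exp_coeff (n : nat) : R := / (2 ^ n * INR (fact n)).

Lemma half_exp_coeff_succ (n : nat) : INR (S n) * half_exp_coeff (S n) = half_exp_coeff n / 2.
Proof.
  unfold half_exp_coeff. change (fact (S n)) with (S n * fact n)%nat. rewrite mult_INR.
  assert (H1 := INR_fact_neq_0 n). assert (H2 : 2 ^ n <> 0) by (apply pow_nonzero; lra).
  assert (H3 : INR (S n) <> 0) by (apply not_0_INR; discriminate).
  simpl pow. field. auto.
Qed.

(* The [n]-th Taylor coefficient of [exp (x / 2) * sum_j h_j x^j]. *)
Definition exp_conv (h : nat -> C) (n : nat) : C :=
  Csum (fun j => half_exp_coeff (n - j) * h j)%C n.

(** The Leibniz rule for x d/dx on exp(x/2) h, read in degree n + 1. In each term of the convolution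
    n + 1 is split as (n + 1 - j) + j, the first part acting on the exponential and the second on
    [h]. *)
Lemma exp_conv_euler (h : nat -> C) (n : nat) :
  (INR (S n) * exp_conv h (S n) = exp_conv h n / 2 + exp_conv (fun j => INR j * h j) (S n))%C.
Proof.
  unfold exp_conv.
  rewrite !Csum_S, Nat.sub_diag.
  rewrite Cmult_plus_distr_l, <- Csum_scal.
  rewrite (Csum_ext _ (fun j => / 2 * (half_exp_coeff (n - j) * h j) + half_exp_coeff (S n - j) * (INR j * h j))%C).
  - rewrite Csum_plus, Csum_scal. unfold Cdiv. ring.
  - intros j Hj. replace (S n - j)%nat with (S (n - j)) by lia.
    assert (H := f_equal RtoC (half_exp_coeff_succ (n - j))).
    unfold Rdiv in H. rewrite !RtoC_mult, RtoC_inv in H by lra.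
    replace (RtoC (INR (S n))) with (INR (S (n - j)) + INR j)%C.
    + replace ((INR (S (n - j)) + INR j) * (half_exp_coeff (S (n - j)) * h j))%C
        with ((INR (S (n - j)) * half_exp_coeff (S (n - j))) * h j
          + half_exp_coeff (S (n - j)) * (INR j * h j))%C by ring.
      rewrite H. ring.
    + rewrite <- RtoC_plus, <- plus_INR. do 2 f_equal. lia.
Qed.

(* In terms of [g = exp (x / 2) h], the equation [x h'' + 2 a h' = x h / 4] for [h]
   becomes Kummer's equation [x g'' + (2 a - x) g' = a g]. *)
Lemma exp_conv_kummer (a : C) (h : nat -> C) :
  h 1%nat = RtoC 0 ->
  (forall j, (INR (S (S j)) * (INR (S j) + 2 * a) * h (S (S j)) = h j / 4)%C) ->
  forall n, (INR (S n) * (2 * a + INR n) * exp_conv h (S n) = (a + INR n) * exp_conv h n)%C.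
Proof.
  intros H1 Hh.
  (* With D = x d/dx, these are the coefficients of D h and D^2 h. Multiplied by x, the equation for
     [h] reads D^2 h + (2 a - 1) D h = x^2 h / 4; [U] is this times exp(x/2), in degree n + 2. *)
  set (h' := fun j => (INR j * h j)%C). set (h'' := fun j => (INR j * h' j)%C).
  assert (U : forall n, (exp_conv h'' (S (S n)) + (2 * a - 1) * exp_conv h' (S (S n)) = exp_conv h n / 4)%C).
  { intros n. unfold exp_conv. rewrite <- Csum_scal, <- Csum_plus, !Csum_shift.
    unfold Cdiv. rewrite (Cmult_comm _ (/ 4)), <- Csum_scal.
    unfold h'', h'. rewrite H1. simpl (INR 0).
    rewrite (Csum_ext _ (fun k => / 4 * (half_exp_coeff (n - k) * h k))%C); [ring|].
    intros k _. simpl Nat.sub.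
    replace (/ 4 * (half_exp_coeff (n - k) * h k))%C with (half_exp_coeff (n - k) * (h k / 4))%C
      by (unfold Cdiv; ring).
    rewrite <- Hh, (S_INR (S k)), RtoC_plus. ring. }
  intros [|n].
  - unfold exp_conv. simpl Csum. simpl Nat.sub. rewrite H1. unfold half_exp_coeff. simpl.
    rewrite !Rmult_1_r, Rinv_1, RtoC_inv by lra. field.
  (* In these four relations [exp_conv h n] cancels, which leaves the recurrence between consecutive
     coefficients. *)
  - assert (E0 := exp_conv_euler h (S n)). assert (E1 := exp_conv_euler h n).
    assert (E2 := exp_conv_euler h' (S n)). assert (E3 := U n).
    fold h' in E0, E1. fold h'' in E2.
    assert (E4 : exp_conv h' (S n) = (INR (S n) * exp_conv h (S n) - exp_conv h n / 2)%C)
      by (rewrite E1; ring).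
    assert (E5 : exp_conv h'' (S (S n)) = (exp_conv h n / 4 - (2 * a - 1) * exp_conv h' (S (S n)))%C)
      by (rewrite <- E3; ring).
    rewrite E5, E4 in E2.
    rewrite (S_INR (S n)), RtoC_plus in *.
    assert (E6 : ((2 * a + INR (S n)) * exp_conv h' (S (S n)) = INR (S n) * exp_conv h (S n) / 2)%C).
    { replace ((2 * a + INR (S n)) * exp_conv h' (S (S n)))%C
        with ((INR (S n) + 1) * exp_conv h' (S (S n)) + (2 * a - 1) * exp_conv h' (S (S n)))%C by ring.
      rewrite E2. field. }
    replace ((INR (S n) + 1) * (2 * a + INR (S n)) * exp_conv h (S (S n)))%C
      with ((2 * a + INR (S n)) * ((INR (S n) + 1) * exp_conv h (S (S n))))%C by ring.
    rewrite E0, Cmult_plus_distr_l, E6. field.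
Qed.

Lemma exp_conv_eq_pochhammer (a : C) (h : nat -> C) :
  nonpole (2 * a) -> h 0%nat = RtoC 1 -> h 1%nat = RtoC 0 ->
  (forall j, (INR (S (S j)) * (INR (S j) + 2 * a) * h (S (S j)) = h j / 4)%C) ->
  forall n, exp_conv h n = (pochhammer a n / pochhammer (2 * a) n / INR (fact n))%C.
Proof.
  intros Ha H0 H1 Hh n. induction n as [|n IH].
  - unfold exp_conv, half_exp_coeff. simpl. rewrite H0, Rmult_1_r, Rinv_1. field.
  - assert (K := exp_conv_kummer a h H1 Hh n). rewrite IH in K.
    assert (N1 := Ha n). assert (N2 := INR_C_neq_0 n).
    assert (N3 := pochhammer_neq_0 _ n Ha).
    assert (N4 : RtoC (INR (fact n)) <> 0) by apply RtoC_neq_0, INR_fact_neq_0.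
    change (fact (S n)) with (S n * fact n)%nat. rewrite mult_INR, RtoC_mult. simpl pochhammer.
    replace (exp_conv h (S n))
      with ((INR (S n) * (2 * a + INR n) * exp_conv h (S n)) / (INR (S n) * (2 * a + INR n)))%C
      by (field; auto).
    rewrite K. field. auto.
Qed.

(** The 0F1 series in x^2/16, re-indexed by powers of x as the convolution with exp(x/2)
    requires. *)
Definition hyp0F1_coeff (c : C) (n : nat) : C :=
  if Nat.even n then (/ (16 ^ Nat.div2 n * INR (fact (Nat.div2 n)) * pochhammer c (Nat.div2 n)))%C
  else RtoC 0.

Lemma hyp0F1_coeff_even (c : C) (k : nat) :
  hyp0F1_coeff c (2 * k) = (/ (16 ^ k * INR (fact k) * pochhammer c k))%C.
Proof.
  unfold hyp0F1_coeff. rewrite Nat.even_mul, Nat.div2_double. reflexivity.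
Qed.

Lemma hyp0F1_coeff_odd (c : C) (k : nat) : hyp0F1_coeff c (2 * k + 1) = RtoC 0.
Proof. unfold hyp0F1_coeff. now rewrite Nat.even_add, Nat.even_mul. Qed.

(** For j = 2 k and c = a + 1/2 the factors on the left are 2 (k + 1) and 2 (c + k), while
    consecutive even coefficients have ratio 1/(16 (k + 1)(c + k)); for odd j both sides vanish. *)
Lemma hyp0F1_coeff_ode (a : C) (j : nat) : nonpole (a + / 2) ->
  (INR (S (S j)) * (INR (S j) + 2 * a) * hyp0F1_coeff (a + / 2) (S (S j))
   = hyp0F1_coeff (a + / 2) j / 4)%C.
Proof.
  intros Hc. destruct (Nat.even j) eqn:E.
  - apply Nat.even_spec in E. destruct E as [k ->].
    replace (S (S (2 * k))) with (2 * S k)%nat by lia.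
    rewrite !hyp0F1_coeff_even.
    change (fact (S k)) with (S k * fact k)%nat. rewrite !mult_INR, (S_INR (2 * k)), !mult_INR.
    rewrite !RtoC_plus, !RtoC_mult. change (INR 2) with (1 + 1). rewrite RtoC_plus.
    simpl pochhammer. rewrite Cpow_S.
    assert (N1 := Hc k). assert (N2 := pochhammer_neq_0 _ k Hc).
    assert (N3 : RtoC (INR (fact k)) <> 0) by apply RtoC_neq_0, INR_fact_neq_0.
    assert (N4 : (16 ^ k)%C <> 0) by (apply Cpow_nz, RtoC_neq_0; lra).
    assert (N5 := INR_C_neq_0 k).
    assert (N6 : (2 * a + 1 + 2 * INR k)%C <> 0).
    { intros Z. apply N1. replace (a + / 2 + INR k)%C with ((2 * a + 1 + 2 * INR k) / 2)%C by field.
      rewrite Z. field. }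
    field. repeat split; auto.
    intros Z. apply N6. rewrite <- Z. ring.
  - unfold hyp0F1_coeff. simpl Nat.even. rewrite E. field.
Qed.

Lemma is_series_exp (y : R) : is_series (fun n => / INR (fact n) * y ^ n) (exp y).
Proof.
  apply is_series_ext with (2 := is_exp_Reals y). intros n.
  change (pow_n y n * / INR (fact n) = / INR (fact n) * y ^ n). rewrite pow_n_pow. ring.
Qed.

Lemma is_series_exp_conv (h : nat -> R) (x s : R) :
  is_series (fun n => h n * x ^ n) s -> ex_series (fun n => Rabs (h n * x ^ n)) ->
  is_series (fun n => sum_f_R0 (fun k => half_exp_coeff (n - k) * h k) n * x ^ n) (s * exp (x / 2)).
Proof.
  intros H Habs.
  assert (M := is_series_mult _ _ _ _ H (is_series_exp (x / 2)) Habs).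
  apply is_series_ext with (2 := M ltac:(
    apply ex_series_ext with (2 := ex_series_exp (Rabs (x / 2))); intros n;
    rewrite Rabs_mult, <- RPow_abs, (Rabs_pos_eq (/ _));
      [easy | left; apply Rinv_0_lt_compat, INR_fact_lt_0])).
  intros n. rewrite Rmult_comm, scal_sum. apply sum_eq. intros k Hk.
  unfold half_exp_coeff. replace (x ^ n) with (x ^ k * x ^ (n - k)) by (rewrite <- pow_add; f_equal; lia).
  unfold Rdiv. rewrite Rpow_mult_distr, pow_inv, Rinv_mult. ring.
Qed.

Lemma is_series_even (u : nat -> R) (x s : R) :
  (forall k, u (2 * k + 1)%nat = 0) -> is_series (fun k => u (2 * k)%nat * (x ^ 2) ^ k) s ->
  is_series (fun n => u n * x ^ n) s.
Proof.
  intros Hodd H.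
  replace s with (s + x * 0) by ring.
  assert (G : forall (v : nat -> R) y l, is_series (fun n => v n * y ^ n) l <-> is_pseries v y l).
  { intros v y l. split; apply is_series_ext; intros n.
    - change (v n * y ^ n = pow_n y n * v n). rewrite (pow_n_pow y n). apply Rmult_comm.
    - change (pow_n y n * v n = v n * y ^ n). rewrite (pow_n_pow y n). apply Rmult_comm. }
  apply G, is_pseries_odd_even; apply G; [exact H|].
  (* The odd part is the zero series, obtained as 0 times a convergent series. *)
  assert (K := is_series_scal (V := R_NormedModule) 0 _ _ (is_series_exp 0)).
  change (is_series (fun n => 0 * (/ INR (fact n) * 0 ^ n)) (0 * exp 0)) in K.
  rewrite Rmult_0_l in K. apply is_series_ext with (2 := K).
  intros n. rewrite Hodd, !Rmult_0_l. reflexivity.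
Qed.

Lemma ex_series_R_le (u a : nat -> R) :
  (forall n, Rabs (u n) <= a n) -> ex_series a -> ex_series u.
Proof. exact (ex_series_le (K := R_AbsRing) (V := R_CompleteNormedModule) u a). Qed.

Lemma Re_mult_RtoC (u : C) (r : R) : Re (u * r) = Re u * r.
Proof. unfold Re, Cmult, RtoC. simpl. ring. Qed.

Lemma Im_mult_RtoC (u : C) (r : R) : Im (u * r) = Im u * r.
Proof. unfold Im, Cmult, RtoC. simpl. ring. Qed.

(** Since exp(x/2) has real coefficients and [x] is real, the convolution acts on real and imaginary
    parts separately, and the real Cauchy product applies to each. *)
Lemma Csums_exp_conv (h : nat -> C) (x : R) (s : C) :
  Csums (fun n => h n * (x ^ n)%R)%C s -> ex_series (fun n => Cmod (h n * (x ^ n)%R)) ->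
  Csums (fun n => exp_conv h n * (x ^ n)%R)%C (s * exp (x / 2))%C.
Proof.
  intros [H1 H2] Ha. unfold Csums. rewrite Re_mult_RtoC, Im_mult_RtoC. split.
  - apply is_series_ext with (fun n => sum_f_R0 (fun k => half_exp_coeff (n - k) * Re (h k)) n * x ^ n).
    { intros n. rewrite Re_mult_RtoC. f_equal. unfold exp_conv. rewrite Re_Csum. apply sum_eq.
      intros k _. rewrite Cmult_comm, Re_mult_RtoC. apply Rmult_comm. }
    apply is_series_exp_conv.
    + apply is_series_ext with (2 := H1). intros n. apply Re_mult_RtoC.
    + apply ex_series_R_le with (2 := Ha). intros n. rewrite Rabs_Rabsolu, <- Re_mult_RtoC. apply re_le_Cmod.
  - apply is_series_ext with (fun n => sum_f_R0 (fun k => half_exp_coeff (n - k) * Im (h k)) n * x ^ n).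
    { intros n. rewrite Im_mult_RtoC. f_equal. unfold exp_conv. rewrite Im_Csum. apply sum_eq.
      intros k _. rewrite Cmult_comm, Im_mult_RtoC. apply Rmult_comm. }
    apply is_series_exp_conv.
    + apply is_series_ext with (2 := H2). intros n. apply Im_mult_RtoC.
    + apply ex_series_R_le with (2 := Ha). intros n. rewrite Rabs_Rabsolu, <- Im_mult_RtoC. apply im_le_Cmod.
Qed.

Lemma Csums_even (h : nat -> C) (x : R) :
  (forall k, h (2 * k + 1)%nat = RtoC 0) ->
  ex_series (fun k => Cmod (h (2 * k)%nat * ((x ^ 2) ^ k)%R)) ->
  Csums (fun n => h n * (x ^ n)%R)%C (CSeries (fun k => h (2 * k)%nat * ((x ^ 2) ^ k)%R)%C) /\
  ex_series (fun n => Cmod (h n * (x ^ n)%R)).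
Proof.
  intros Hodd Ha.
  destruct (Csums_dominated _ _ (fun n => Rle_refl _) Ha) as [H1 H2].
  split.
  - split.
    + apply is_series_ext with (fun n => Re (h n) * x ^ n); [intros; symmetry; apply Re_mult_RtoC|].
      apply is_series_even; [intros k; now rewrite Hodd|].
      apply is_series_ext with (2 := H1). intros; apply Re_mult_RtoC.
    + apply is_series_ext with (fun n => Im (h n) * x ^ n); [intros; symmetry; apply Im_mult_RtoC|].
      apply is_series_even; [intros k; now rewrite Hodd|].
      apply is_series_ext with (2 := H2). intros; apply Im_mult_RtoC.
  - destruct Ha as [A HA]. exists A.
    apply is_series_ext with (fun n => Cmod (h n) * Rabs x ^ n).
    { intros n. now rewrite Cmod_mult, Cmod_R, RPow_abs. }
    apply is_series_even; [intros k; rewrite Hodd; apply Cmod_0|].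
    apply is_series_ext with (2 := HA). intros k.
    now rewrite Cmod_mult, Cmod_R, <- RPow_abs, <- (RPow_abs x 2).
Qed.

Lemma hyp1F1_kummer_second (a : C) (x : R) : nonpole (2 * a) ->
  (Cexp (- x / 2) * hyp1F1 a (2 * a) x)%C = hyp0F1 (a + / 2) (x ^ 2 / 16).
Proof.
  intros Ha.
  assert (Hc : nonpole (a + / 2)).
  { intros n Z. apply (Ha (2 * n + 1)%nat).
    rewrite plus_INR, mult_INR, RtoC_plus, RtoC_mult. simpl (INR 1). change (INR 2) with (1 + 1).
    rewrite RtoC_plus.
    replace (2 * a + ((1 + 1) * INR n + 1))%C with (2 * (a + / 2 + INR n))%C by field.
    rewrite Z. ring. }
  set (c := (a + / 2)%C) in *. set (h := hyp0F1_coeff c).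
  destruct (hyp0F1_deriv c (x ^ 2 / 16) Hc) as [HS _].
  assert (T : forall k, ((x ^ 2 / 16)%R ^ k / (INR (fact k) * pochhammer c k) = h (2 * k)%nat * ((x ^ 2) ^ k)%R)%C).
  { intros k. unfold h. rewrite hyp0F1_coeff_even.
    assert (N2 := pochhammer_neq_0 _ k Hc).
    assert (N3 : RtoC (INR (fact k)) <> 0) by apply RtoC_neq_0, INR_fact_neq_0.
    assert (N4 : (16 ^ k)%C <> 0) by (apply Cpow_nz, RtoC_neq_0; lra).
    rewrite RtoC_pow, RtoC_div by lra. unfold Cdiv at 2. rewrite Cpow_mult_l, Cpow_inv by (apply RtoC_neq_0; lra).
    field. auto. }
  destruct (Csums_even h x (hyp0F1_coeff_odd c)) as [H1 H2].
  { apply ex_series_ext with (2 := HS). intros k. now rewrite T. }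
  rewrite <- (CSeries_ext _ _ T) in H1. fold (hyp0F1 c (x ^ 2 / 16)) in H1.
  assert (E : hyp1F1 a (2 * a) x = (hyp0F1 c (x ^ 2 / 16) * exp (x / 2))%C).
  { apply Csums_unique. apply Csums_ext with (2 := Csums_exp_conv h x _ H1 H2).
    intros n. rewrite (exp_conv_eq_pochhammer a h Ha).
    - rewrite <- RtoC_pow. unfold Cdiv. ring.
    - unfold h, hyp0F1_coeff. simpl. field.
    - exact (hyp0F1_coeff_odd c 0).
    - intros j. now apply hyp0F1_coeff_ode. }
  rewrite E. replace (- x / 2)%C with (RtoC (- (x / 2))) by (rewrite RtoC_opp, RtoC_div by lra; field).
  rewrite Cexp_RtoC, exp_Ropp, RtoC_inv by apply Rgt_not_eq, exp_pos.
  field. apply RtoC_neq_0, Rgt_not_eq, exp_pos.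
Qed.

(** * The Whittaker function *)

(** A positive factor leaves the principal argument unchanged, also for negative [x]. *)
Lemma Cln_scale (c x : R) : 0 < c -> x <> 0 -> Cln (c * x) = (ln c + Cln x)%C.
Proof.
  intros Hc Hx. rewrite <- RtoC_mult. unfold Cln, Carg. rewrite !Cmod_R, Rabs_mult, (Rabs_pos_eq c) by lra.
  simpl. destruct (Rle_dec 0 0) as [_ | H]; [|lra].
  assert (Hax := Rabs_pos_lt x Hx).
  replace (c * x / (c * Rabs x)) with (x / Rabs x) by (field; lra).
  unfold Cplus, RtoC. simpl. rewrite ln_mult, Rplus_0_l by easy. reflexivity.
Qed.

Lemma Cpower_scale (c x : R) (a : C) :
  0 < c -> x <> 0 -> Cpower (c * x) a = (Cpower c a * Cpower x a)%C.
Proof.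
  intros Hc Hx. assert (H1 : RtoC c <> 0) by (apply RtoC_neq_0; lra).
  assert (H2 := RtoC_neq_0 x Hx).
  rewrite !Cpower_neq_0 by (try apply Cmult_neq_0; easy).
  rewrite Cln_scale, (Cln_pos c), <- Cexp_add by easy. f_equal. ring.
Qed.

Lemma Cpower_add (z a b : C) : z <> 0 -> Cpower z (a + b) = (Cpower z a * Cpower z b)%C.
Proof.
  intros Hz. rewrite !Cpower_neq_0, <- Cexp_add by easy. f_equal. ring.
Qed.

Lemma Cpower_0_l (a : C) : a <> 0 -> Cpower 0 a = RtoC 0.
Proof.
  intros Ha. unfold Cpower. destruct (Ceq_dec 0 0) as [_ | H]; [|easy].
  now destruct (Ceq_dec a 0).
Qed.

Lemma Cderiv_Cpower (z a : C) : z <> 0 -> Cderiv (Cpower z) a (Cln z * Cpower z a)%C.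
Proof.
  intros Hz. apply (Cderiv_ext_loc (fun w => Cexp (w * Cln z)) _ _ _ 1 Rlt_0_1).
  - intros w _. now rewrite Cpower_neq_0.
  - rewrite Cpower_neq_0 by easy.
    exact (Cderiv_comp Cexp (fun w => w * Cln z)%C a _ _ (Cderiv_Cexp _) (Cderiv_mul_const _ _)).
Qed.

(** Gamma(1 + nu + k) = (1 + nu)_k Gamma(1 + nu), so one Gamma value factors out of all
    coefficients. *)
Lemma besselI_eq (nu : C) (x : R) : nonpole (1 + nu) ->
  besselI nu (x / 2) =
  (Cpower (x / 2 / 2) nu * (hyp0F1 (1 + nu) (x ^ 2 / 16) * / CGamma (1 + nu)))%C.
Proof.
  intros Hnu. unfold besselI. f_equal. rewrite Cmult_comm.
  apply Csums_unique.
  destruct (hyp0F1_deriv _ (x ^ 2 / 16) Hnu) as [HS _].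
  apply Csums_ext with (2 := Csums_scal _ _ _ (Csums_dominated _ _ (fun n => Rle_refl _) HS)).
  intros k. replace (nu + INR k + 1)%C with (1 + nu + INR k)%C by ring.
  rewrite CGamma_add_INR by easy.
  rewrite Cpow_mult_r.
  replace ((x / 2 / 2) ^ 2)%C with (RtoC (x ^ 2 / 16)%R).
  - unfold Cdiv. rewrite !Cinv_mul. ring.
  - rewrite RtoC_div by lra. rewrite RtoC_pow. simpl Cpow. field.
Qed.

Lemma nonpole_half (c : C) : nonpole (2 * c) -> nonpole c.
Proof.
  intros H n Z. apply (H (2 * n)%nat). rewrite mult_INR, RtoC_mult. change (INR 2) with 2.
  replace (2 * c + 2 * INR n)%C with (2 * (c + INR n))%C by ring. rewrite Z. ring.
Qed.

(** The conclusion says that 2 mu avoids -2, -3, ...; the value -1, which the domain admits through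
    its second clause, stays inside, so a full neighbourhood of -1/2 satisfies it. *)
Lemma whittakerM_dom_nonpole (mu : C) : whittakerM_dom 0 mu -> nonpole (2 * (1 + mu)).
Proof.
  intros [H | [_ ->]] n Z.
  - apply (H (S n)). rewrite RtoC_opp, !S_INR, !RtoC_plus.
    replace (2 * mu)%C with (2 * (1 + mu) + INR n - 2 - INR n)%C by ring. rewrite Z. ring.
  - apply (INR_C_neq_0 n). rewrite S_INR, RtoC_plus, <- Z, RtoC_opp, RtoC_inv by lra. field.
Qed.

Lemma whittakerM_0_eq (nu : C) (x : R) : x <> 0 -> nonpole (2 * (1 + nu)) ->
  whittakerM 0 nu x = (Cpower 4 nu * CGamma (1 + nu) * Csqrt x * besselI nu (x / 2))%C.
Proof.
  intros Hx Hnu. unfold whittakerM. destruct (Ceq_dec 0 0) as [_ | H]; [|easy].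
  destruct (Ceq_dec nu (RtoC (- / 2))) as [-> | Hne]; [easy|].
  (* Index 0 is excluded by nu <> -1/2, and index n + 1 is index n of [Hnu]. *)
  assert (Ha : nonpole (2 * (nu + / 2))).
  { intros [|n] Z.
    - apply Hne. simpl in Z. rewrite RtoC_opp, RtoC_inv by lra.
      replace nu with ((2 * (nu + / 2) + 0) / 2 - / 2)%C by field. rewrite Z. field.
    - apply (Hnu n). rewrite <- Z, S_INR, RtoC_plus. field. }
  unfold whittakerM_1F1.
  replace (/ 2 + nu - 0)%C with (nu + / 2)%C by ring.
  replace (1 + 2 * nu)%C with (2 * (nu + / 2))%C by field.
  rewrite <- Cmult_assoc, hyp1F1_kummer_second by easy.
  replace (nu + / 2 + / 2)%C with (1 + nu)%C by field.
  assert (Hc := nonpole_half _ Hnu).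
  rewrite besselI_eq, Cpower_add by (try apply RtoC_neq_0; easy).
  (* This produces the factor 4^nu and leaves (x/4)^nu, the prefactor of the Bessel function at
     x/2. *)
  replace (RtoC x) with (4 * (x / 4)%R)%C at 1 by (rewrite RtoC_div by lra; field).
  rewrite Cpower_scale by lra.
  replace (x / 2 / 2)%C with (RtoC (x / 4)) by (rewrite RtoC_div by lra; field).
  unfold Csqrt. field. now apply CGamma_neq_0.
Qed.

(** The exponent nu + 1/2 vanishes, and 0^0 = 1 would intervene, only at nu = -1/2; there the Bessel
    form supplies the factor [Csqrt 0], which is 0. *)
Lemma whittakerM_0_0 (nu : C) : whittakerM 0 nu 0 = RtoC 0.
Proof.
  unfold whittakerM. destruct (Ceq_dec 0 0) as [_ | H]; [|easy].
  destruct (Ceq_dec nu (RtoC (- / 2))) as [-> | Hne].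
  - unfold Csqrt. rewrite (Cpower_0_l (/ 2)); [ring|].
    rewrite <- RtoC_inv by lra. apply RtoC_neq_0. lra.
  - unfold whittakerM_1F1. rewrite (Cpower_0_l (nu + / 2)); [ring|].
    intros Z. apply Hne. rewrite RtoC_opp, RtoC_inv by lra.
    replace nu with ((nu + / 2) - / 2)%C by ring. rewrite Z. ring.
Qed.

Lemma Cderiv_CGamma_shift (mu : C) : nonpole (1 + mu) ->
  Cderiv (fun nu => CGamma (1 + nu)) mu (C_derive CGamma (1 + mu)).
Proof.
  intros H. destruct (Cderiv_CGamma (1 + mu) H) as [D HD].
  rewrite (is_C_derive_unique _ _ D) by now apply is_derive_Cderiv.
  replace D with (1 * D)%C by ring.
  exact (Cderiv_comp CGamma (fun nu => 1 + nu)%C mu _ _ HD (Cderiv_add_const _ _)).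
Qed.

Lemma Cderiv_besselI (mu : C) (x : R) : x <> 0 -> nonpole (1 + mu) ->
  exists D, Cderiv (fun nu => besselI nu (x / 2)) mu D.
Proof.
  intros Hx H. destruct (hyp0F1_deriv (1 + mu) (x ^ 2 / 16) H) as [_ [D HD]].
  destruct (nonpole_open _ H) as [m [Hm Hw]].
  eexists.
  apply (Cderiv_ext_loc (fun nu => Cpower (x / 2 / 2) nu * (hyp0F1 (1 + nu) (x ^ 2 / 16) * / CGamma (1 + nu)))%C
    _ _ _ m); [easy| |].
  - intros w Hwm. symmetry. apply besselI_eq. intros n. apply Cmod_gt_0.
    assert (E := Hw (1 + w)%C ltac:(replace (1 + w - (1 + mu))%C with (w - mu)%C by ring; easy) n). lra.
  - apply Cderiv_mult; [|apply Cderiv_mult].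
    + apply Cderiv_Cpower. replace (x / 2 / 2)%C with (RtoC (x / 4)) by (rewrite RtoC_div by lra; field).
      apply RtoC_neq_0. lra.
    + exact (Cderiv_comp (fun c => hyp0F1 c (x ^ 2 / 16)) (fun nu => 1 + nu)%C mu _ _ HD (Cderiv_add_const _ _)).
    + apply Cderiv_inv; [now apply CGamma_neq_0 | now apply Cderiv_CGamma_shift].
Qed.

(** [C_derive] has a value even where no derivative exists; the second conjunct certifies that the
    one in the formula is genuine for x <> 0, and for x = 0 when Re mu > 0. *)
Theorem theorem10 (x : R) (mu : C) (hmu : whittakerM_dom 0 mu) :
  is_derive (K := C_AbsRing) (V := C_NormedModule)
    (fun nu : C => whittakerM 0 nu x) mu
    (Cpower 4 mu * Csqrt x * CGamma (1 + mu) *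
      (besselI mu (x / 2) * (ln 4 + Cdigamma (1 + mu))
       + C_derive (fun nu : C => besselI nu (x / 2)) mu))%C
  /\ (x <> 0 \/ 0 < Re mu ->
      ex_derive (K := C_AbsRing) (V := C_NormedModule)
        (fun nu : C => besselI nu (x / 2)%C) mu).
Proof.
  assert (H2 := whittakerM_dom_nonpole mu hmu). assert (H1 := nonpole_half _ H2).
  destruct (Req_dec x 0) as [-> | Hx].
  - split.
    + apply is_derive_Cderiv.
      (* At x = 0 this factor annihilates the bracket, whatever value [C_derive] takes there. *)
      replace (Csqrt 0) with (RtoC 0).
      2:{ unfold Csqrt. rewrite Cpower_0_l; [easy|].
          rewrite <- RtoC_inv by lra. apply RtoC_neq_0. lra. }
      replace (Cpower 4 mu * 0 * CGamma (1 + mu) * _)%C with (RtoC 0) by ring.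
      apply (Cderiv_ext_loc (fun _ => RtoC 0) _ _ _ 1 Rlt_0_1); [|apply Cderiv_const].
      intros w _. symmetry. apply whittakerM_0_0.
    + intros [H | Hre]; [easy|]. exists (RtoC 0). apply is_derive_Cderiv.
      (* The disc of radius Re mu excludes nu = 0, the only order at which 0^nu is not 0. *)
      apply (Cderiv_ext_loc (fun _ => RtoC 0) _ _ _ (Re mu) Hre); [|apply Cderiv_const].
      intros w Hw. unfold besselI. replace (0 / 2 / 2)%C with (RtoC 0) by field.
      rewrite Cpower_0_l; [ring|]. intros ->.
      replace (0 - mu)%C with (- mu)%C in Hw by ring. rewrite Cmod_opp in Hw.
      assert (L := re_le_Cmod mu). assert (L' := Rle_abs (Re mu)). lra.
  - destruct (Cderiv_besselI mu x Hx H1) as [D HD].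
    assert (ED := proj2 (is_derive_Cderiv _ _ _) HD).
    split; [|intros _; now exists D].
    rewrite (is_C_derive_unique _ _ _ ED).
    apply is_derive_Cderiv.
    destruct (nonpole_open _ H2) as [m [Hm Hw]].
    (* Half of [m], since [2 * (1 + nu)] moves twice as fast as [nu]. *)
    apply (Cderiv_ext_loc (fun nu => Cpower 4 nu * CGamma (1 + nu) * Csqrt x * besselI nu (x / 2))%C
      _ _ _ (m / 2)); [lra| |].
    + intros w Hwm. symmetry. apply whittakerM_0_eq; [easy|].
      intros n. apply Cmod_gt_0.
      assert (E : Cmod (2 * (1 + w) - 2 * (1 + mu)) < m).
      { replace (2 * (1 + w) - 2 * (1 + mu))%C with (2 * (w - mu))%C by ring.
        rewrite Cmod_mult, Cmod_R, Rabs_pos_eq; lra. }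
      generalize (Hw _ E n). lra.
    + assert (H4 : RtoC 4 <> 0) by (apply RtoC_neq_0; lra).
      assert (P := Cderiv_mult _ _ _ _ _ (Cderiv_mult _ _ _ _ _
        (Cderiv_mult _ _ _ _ _ (Cderiv_Cpower 4 mu H4) (Cderiv_CGamma_shift mu H1))
        (Cderiv_const (Csqrt x) mu)) HD).
      rewrite Cln_pos in P by lra.
      replace (_ * _)%C with
        (((ln 4 * Cpower 4 mu * CGamma (1 + mu) + Cpower 4 mu * C_derive CGamma (1 + mu)) * Csqrt x
          + Cpower 4 mu * CGamma (1 + mu) * 0) * besselI mu (x / 2)
         + Cpower 4 mu * CGamma (1 + mu) * Csqrt x * D)%C; [exact P|].
      (* The product rule yields Gamma' itself; digamma appears because Gamma is factored out. *)
      unfold Cdigamma. field. now apply CGamma_neq_0.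
Qed.
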